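(* The invariant $\mathfrak{D}(G)$ of any finite group $G$ determines: (1) the order of $G$; (2) the number, orders, and relative positions of subgroups of $G$ (the subgroup graph $\mathfrak{S}(G)$), therefore the (positions of the) intersection and join of subgroups; (3) the (positions of) normal subgroups of $G$, hence whether $G$ is simple or not; (4) the division graph $\mathfrak{D}(H)$ of any subgroup $H$ of $G$; (5) the division graph $\mathfrak{D}(G/H)$ for any normal subgroup $H$ of $G$; (6) the number of divisions of $G$; (7) the (positions of) cyclic subgroups of $G$, possibly $G$ itself; (8) the number of elements in a division $\delta$ of $G$, and the (positions of the) cyclic groups generated by these elements; (9) which cyclic subgroups of $G$ are conjugates of each other; (10) the minimum number of generators for $G$; (11) the (position of the) normalizer $N_G(H)$ of any subgroup $H$ of $G$; (12) whether $G$ is abelian or not, and if so, the correct composition of factors; (13) the (positions of) abelian subgroups of $G$; (14) the (position of the) center $Z(G)$ of $G$, as well as the centralizer of any subgroup; (15) the (positions of) direct factors of $G$, if more than one; (16) whether $G$ is a semidirect product or not; (17) the division graphs of a composition series of $G$ and those of its unique simple factors; (18) the (position of the) commutator subgroup $G'=[G,G]$ of $G$; (19) whether $G$ is nilpotent/solvable.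
   Context: Let $G$ be a finite group. Two elements $\phi_1,\phi_2\in G$ lie in the same division of $G$ if the cyclic subgroups $\langle\phi_1\rangle$ and $\langle\phi_2\rangle$ are conjugate in $G$. The subgroup graph $\mathfrak{S}(G)$ is the Hasse diagram of the subgroup lattice of $G$ (vertices colored by subgroups, arcs for covering inclusions pointing toward the smaller subgroup, labeled by the relative index). For a division with representative $\phi$, let $D=\langle\phi\rangle$ act on the right on each coset set $H\backslash G$; the connected graph (unramified splitting type) for this division has as vertices of color $H$ the $D$-orbits on $H\backslash G$, and for each covering $K<H$ in $\mathfrak{S}(G)$ an arc from a $D$-orbit $O$ in $H\backslash G$ to each $D$-orbit $O'$ in $K\backslash G$ lying over $O$ under the natural map $Kx\mapsto Hx$, labeled by $|O'|/|O|$. (Number-theoretically, for a normal extension of number fields $\mathbf{L}/\mathbf{k}$ with Galois group $G$, this graph records how an unramified prime of $\mathbf{k}$ with Frobenius automorphism $\phi$ splits in every intermediate field, the labels being inertial degrees.) This graph depends only on the division of $\phi$. The division graph $\mathfrak{D}(G)$ is the disjoint union of these connected graphs over all divisions of $G$. Colors are treated as featureless: one only knows which vertices (in every component) share a color, not which subgroup the color is. *)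

(* Defs.v *)
From HB Require Import structures.
From mathcomp Require Export all_boot all_fingroup all_solvable.

Set Implicit Arguments.
Unset Strict Implicit.
Unset Printing Implicit Defensive.

Local Open Scope group_scope.

(* Directed graphs with vertices coloured by C; [arc u v = Some l] means that
   there is an arc from u to v, carrying the label l. *)
Record cgraph (C : finType) := CGraph {
  vertex :> finType;
  colour : vertex -> C;
  arc : vertex -> vertex -> option nat
}.

(* Colours are featureless, so an isomorphism may permute them by any
   bijection s, as long as vertices share a colour iff their images do. *)
Definition cgraph_iso (C1 C2 : finType) (g1 : cgraph C1) (g2 : cgraph C2)
    (s : C1 -> C2) (f : g1 -> g2) : Prop :=
  [/\ bijective s, bijective f,
      forall v, colour (f v) = s (colour v)
    & forall u v, arc (f u) (f v) = arc u v].

Definition cgraph_isomorphic (C1 C2 : finType)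
    (g1 : cgraph C1) (g2 : cgraph C2) : Prop :=
  exists (s : C1 -> C2) (f : g1 -> g2), cgraph_iso s f.

Definition disjoint_union (C I : finType) (g : I -> cgraph C) : cgraph C :=
  @CGraph C {i : I & g i} (fun v => colour (tagged v))
    (fun u v => if tag u == tag v then arc (tagged u) (tagged_as u v)
                else None).

Record subgroup_of (gT : finGroupType) (G : {group gT}) := Subgroup {
  sgval :> {group gT};
  _ : sgval \subset G
}.

HB.instance Definition _ (gT : finGroupType) (G : {group gT}) :=
  [isSub for @sgval gT G].
HB.instance Definition _ (gT : finGroupType) (G : {group gT}) :=
  [Finite of subgroup_of G by <:].

Definition subgroupT (gT : finGroupType) (G : {group gT}) : subgroup_of G :=
  Subgroup (subxx G).

(* [maximal K H] means that K is maximal among the PROPER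
   subgroups of H, i.e. that H covers K in the subgroup lattice. *)
Definition subgroup_graph (gT : finGroupType) (G : {group gT}) :
    cgraph (subgroup_of G) :=
  @CGraph (subgroup_of G) (subgroup_of G) id
    (fun H K => if maximal K H then Some #|H : K| else None).

Definition same_division (gT : finGroupType) (G : {group gT}) : rel gT :=
  fun x y => [exists g in G, <[y]> == <[x]> :^ g].

Definition divisions (gT : finGroupType) (G : {group gT}) : {set {set gT}} :=
  equivalence_partition (same_division G) G.

Section SplittingGraph.

Variables (gT : finGroupType) (G : {group gT}) (x : gT).

Definition coset_orbits (H : {group gT}) : {set {set {set gT}}} :=
  [set orbit 'Rs%act <[x]> C | C in rcosets H G].

Definition splitting_vertex : finType :=
  {v : subgroup_of G * {set {set gT}} | v.2 \in coset_orbits v.1}.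

(* For K \subset H the natural map K :* g |-> H :* g is C |-> H * C. *)
Definition lies_over (H : {group gT}) (W U : {set {set gT}}) : bool :=
  [set (H * C : {set gT}) | C in W] == U.

Definition splitting_graph : cgraph (subgroup_of G) :=
  @CGraph (subgroup_of G) splitting_vertex (fun v => (val v).1)
    (fun u v => let: (H, U) := val u in let: (K, W) := val v in
       if maximal K H && lies_over H W U then Some (#|W| %/ #|U|)%N
       else None).

End SplittingGraph.

(* Up to colour-preserving isomorphism, the choice of the representative
   [repr d] of the division d is irrelevant. *)
Definition division_graph (gT : finGroupType) (G : {group gT}) :
    cgraph (subgroup_of G) :=
  disjoint_union (fun d : {d : {set gT} | d \in divisions G} =>
                    splitting_graph G (repr (val d))).

Definition division_of (gT : finGroupType) (G : {group gT})
    (v : division_graph G) : {set gT} := val (tag v).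

Section Transport.

Variables (gT1 gT2 : finGroupType) (G1 : {group gT1}) (G2 : {group gT2}).
Variable s : subgroup_of G1 -> subgroup_of G2.

(* The division graphs of H and s H are isomorphic, the colours of the former
   (the subgroups of H) being matched to those of the latter by s itself. *)
Definition same_division_graph (H : subgroup_of G1) : Prop :=
  exists (sH : subgroup_of H -> subgroup_of (s H))
         (f : division_graph H -> division_graph (s H)),
    cgraph_iso sH f /\
    forall (K : subgroup_of H) (L : subgroup_of G1), K :=: L -> sH K :=: s L.

(* Likewise for A1 / N and A2 / s N, where L / N is matched to s L / s N;
   meant for A2 corresponding to A1 under s, and N normal in A1. *)
Definition same_quotient_division_graph
    (A1 : {group gT1}) (A2 : {group gT2}) (N : subgroup_of G1) : Prop :=
  exists (sQ : subgroup_of (A1 / N) -> subgroup_of (A2 / s N))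
         (f : division_graph (A1 / N) -> division_graph (A2 / s N)),
    cgraph_iso sQ f /\
    forall (K : subgroup_of (A1 / N)) (L : subgroup_of G1),
      N \subset L -> L \subset A1 -> K :=: L / N -> sQ K :=: s L / s N.

End Transport.

(* The factors are required to be nontrivial, as G = G ><| 1 always holds. *)
Definition is_semidirect_product (gT : finGroupType) (G : {group gT}) : Prop :=
  exists H K : {group gT}, [/\ H :!=: 1, K :!=: 1 & H ><| K = G].

Definition composition_factors (gT : finGroupType) (G : {group gT})
    (t : seq {group gT}) : seq (section gT) :=
  pairmap (@mkSec gT) G t.

(* Main.v *)
(* With C = <[x]>, the C-orbits on H \ G have as unions the double cosets
   H g C, so a component of the division graph records, for all H at once, the
   double cosets H g C with their sizes and inclusions.  The unique vertex of
   colour G in each component and the arcs below it show that an isomorphism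
   of division graphs is a lattice isomorphism s preserving orders, a bijection
   of divisions, and for each cyclic C a size- and inclusion-preserving
   matching of the H g C with the double cosets of s H and a cyclic group, which
   must be conjugate to s C, because x is conjugate into H iff some H g C has
   size #|H|.

   Right translation by the normaliser of s C allows one to assume that the
   coset C is matched to s C, hence H to s H whenever C \subset H; the part of
   the matching below H is then a matching for the group H itself, and the part
   above a normal subgroup N is one for G / N.  Everything else follows from
   these two restrictions: N is normal iff all N g C with C \subset N have size
   #|N|; normality in subgroups gives normalisers and direct products; a group
   is abelian iff it is a direct product of cyclic groups; commutation is
   commutativity of joins of cyclic subgroups; the derived subgroup is the least
   normal subgroup with abelian quotient. *)

Require Import Defs.

Set Implicit Arguments.
Unset Strict Implicit.
Unset Printing Implicit Defensive.

Local Open Scope group_scope.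

(** * Double cosets *)

Section DoubleCosets.

Variable gT : finGroupType.
Implicit Types (G H K C L : {group gT}) (A B : {set gT}) (x g : gT).

Definition dcosets (G H C : {set gT}) : {set {set gT}} :=
  [set H :* x * C | x in G].

Lemma dcosetsP G H C A :
  reflect (exists2 x, x \in G & A = H :* x * C) (A \in dcosets G H C).
Proof. exact: imsetP. Qed.

Lemma dcoset_refl H C x : x \in H :* x * C.
Proof. by rewrite -[X in X \in _]mulg1 mem_mulg ?rcoset_refl. Qed.

Lemma dcoset_eq H C x y : y \in H :* x * C -> H :* y * C = H :* x * C.
Proof.
case/mulsgP=> _ c /rcosetP[h Hh ->] Cc ->.
by rewrite rcosetM (rcosetM _ h) (rcoset_id Hh) -mulgA lcoset_id.
Qed.

Lemma dcosets_eq G H C A x : A \in dcosets G H C -> x \in A -> A = H :* x * C.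
Proof. by case/dcosetsP=> y _ -> /dcoset_eq->. Qed.

Lemma dcosets_neq0 G H C A : A \in dcosets G H C -> exists x, x \in A.
Proof. by case/dcosetsP=> y _ ->; exists y; rewrite dcoset_refl. Qed.

Lemma dcosets_sub G H C A :
  H \subset G -> C \subset G -> A \in dcosets G H C -> A \subset G.
Proof.
move=> sHG sCG /dcosetsP[x Gx ->].
by rewrite !mul_subG // sub1set.
Qed.

Lemma mem_dcosets G H C x : x \in G -> H :* x * C \in dcosets G H C.
Proof. by move=> Gx; apply/dcosetsP; exists x. Qed.

Lemma dcosets_id G H C : C \subset H -> (H : {set gT}) \in dcosets G H C.
Proof. by move=> sCH; apply/dcosetsP; exists 1; rewrite // mulg1 mulGSid. Qed.

(* Inclusion of double cosets is the relation of lying over each other. *)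
Lemma dcosets_subP G H K C A B : K \subset H ->
    A \in dcosets G H C -> B \in dcosets G K C ->
  reflect (exists2 x, x \in B & x \in A) (B \subset A).
Proof.
move=> sKH AA BB; apply: (iffP idP) => [sBA | [x Bx Ax]].
  have [x Bx] := dcosets_neq0 BB; exists x => //; exact: (subsetP sBA).
by rewrite (dcosets_eq AA Ax) (dcosets_eq BB Bx) !mulSg.
Qed.

Lemma dcosets_inj G H C A B : A \in dcosets G H C -> B \in dcosets G H C ->
  A \subset B -> A = B.
Proof.
move=> AA BB sAB; have [x Ax] := dcosets_neq0 AA.
by rewrite (dcosets_eq AA Ax) (dcosets_eq BB (subsetP sAB x Ax)).
Qed.

Lemma dcosets_up G H K C B : K \subset H -> B \in dcosets G K C ->
  exists2 A, A \in dcosets G H C & B \subset A.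
Proof.
move=> sKH /dcosetsP[x Gx ->]; exists (H :* x * C); first exact: mem_dcosets.
by rewrite !mulSg.
Qed.

Lemma dcosets_mul G H K C A B : K \subset H -> H \subset G ->
    A \in dcosets G H C -> B \in dcosets G K C ->
  (H * B == A) = (B \subset A).
Proof.
move=> sKH sHG AA BB; apply/eqP/idP=> [<- | sBA]; first exact: mulG_subr.
have [x Bx] := dcosets_neq0 BB.
rewrite (dcosets_eq AA (subsetP sBA x Bx)) (dcosets_eq BB Bx).
by rewrite !mulgA mulGSid.
Qed.

Lemma dcoset_card H C x : (#|H :* x * C| == #|H|) = (C :^ x^-1 \subset H).
Proof.
have sHx : H :* x \subset H :* x * C by apply: mulG_subl.
rewrite -(card_rcoset H x) eq_sym; apply/idP/idP => [eqc | sCH].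
  have eHx : H :* x = H :* x * C by apply/eqP; rewrite eqEcard sHx (eqP eqc) /=.
  apply/subsetP=> _ /imsetP[c Cc ->].
  have: x * c \in H :* x by rewrite eHx mem_mulg ?rcoset_refl.
  by rewrite mem_rcoset conjgE invgK mulgA.
suff -> : H :* x * C = H :* x by [].
have -> : H :* x * C = H * (C :^ x^-1) :* x.
  by rewrite conjsgE invgK !mulgA -(mulgA (H :* x * C)) mulg_set1 mulVg mulg1.
by rewrite mulGSid.
Qed.

Lemma dcosets_card1 G H C : H \subset G -> C \subset G ->
  reflect (exists2 x, x \in G & C :^ x \subset H)
          [exists A in dcosets G H C, #|A| == #|H|].
Proof.
move=> sHG sCG; apply: (iffP existsP) => [[A /andP[/dcosetsP[x Gx ->]]] | [x Gx]].
  by rewrite dcoset_card => sCH; exists x^-1; rewrite ?groupV.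
rewrite -[x in _ :^ x]invgK -dcoset_card => cH.
by exists (H :* x^-1 * C); rewrite mem_dcosets ?groupV.
Qed.

(** With [K] and [C] inside [H], a double coset that meets [H] stays in it; this lets a matching for
    [G] be cut down to one for [H]. *)
Lemma dcosets_subgroup G H K C A : H \subset G -> K \subset H -> C \subset H ->
  (A \in dcosets H K C) = (A \in dcosets G K C) && (A \subset H).
Proof.
move=> sHG sKH sCH; apply/idP/andP=> [HA | [/dcosetsP[x Gx ->] sAH]].
  split; last exact: dcosets_sub HA.
  by have /dcosetsP[x Hx ->] := HA; rewrite mem_dcosets ?(subsetP sHG).
by rewrite mem_dcosets // (subsetP sAH) // dcoset_refl.
Qed.

Lemma dcosetsJ G H C A g : g \in G ->
  A \in dcosets G H C -> A :* g \in dcosets G H (C :^ g).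
Proof.
move=> Gg /dcosetsP[x Gx ->]; apply/dcosetsP; exists (x * g); rewrite ?groupM //.
by rewrite rcosetM /= conjsgE !mulgA -(mulgA (H :* x) [set g]) mulg_set1 mulgV mulg1.
Qed.

Lemma rcosets_partition_stable H A : H * A = A -> partition (rcosets H A) A.
Proof.
move=> HA; apply/and3P; split.
- apply/eqP/setP=> y; apply/bigcupP/idP=> [[_ /rcosetsP[z Az ->]] | Ay].
    by case/rcosetP=> h Hh ->; rewrite -HA mem_mulg.
  by exists (H :* y); rewrite ?rcoset_refl //; apply/rcosetsP; exists y.
- apply/trivIsetP=> _ _ /rcosetsP[y _ ->] /rcosetsP[z _ ->] neq.
  apply/pred0P=> u /=; apply: contraNF neq => /andP[/rcoset_eqP<- /rcoset_eqP<-].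
  by [].
- by apply/negP=> /rcosetsP[y _] /setP/(_ y); rewrite rcoset_refl inE.
Qed.

Lemma card_rcosets_stable H A : H * A = A -> (#|rcosets H A| * #|H|)%N = #|A|.
Proof.
move=> HA.
rewrite (card_uniform_partition (n := #|H|) _ (rcosets_partition_stable HA)) //.
by move=> _ /rcosetsP[y _ ->]; rewrite card_rcoset.
Qed.

Lemma dcoset_stable H K C x : K \subset H -> K * (H :* x * C) = H :* x * C.
Proof. by move=> sKH; rewrite !mulgA mulSGid. Qed.

Lemma cover_rcosets_dcoset H C x : cover (rcosets H (H :* x * C)) = H :* x * C.
Proof.
exact: cover_partition (rcosets_partition_stable (dcoset_stable _ _ (subxx H))).
Qed.

Lemma card_dcoset_orbit H C x :
  (#|rcosets H (H :* x * C)| * #|H|)%N = #|H :* x * C|.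
Proof. by rewrite card_rcosets_stable ?dcoset_stable. Qed.

(** Bridge to the splitting graph: moving [H :* x] by [C] sweeps out the right cosets inside one
    double coset, so an orbit can be replaced by its union without loss. *)
Lemma orbit_rcoset H C x :
  orbit 'Rs%act C (H :* x) = rcosets H (H :* x * C).
Proof.
apply/setP=> U; apply/imsetP/rcosetsP=> [[c Cc ->] | [y]].
  by exists (x * c); rewrite ?mem_mulg ?rcoset_refl //= rcosetE rcosetM.
case/mulsgP=> _ c /rcosetP[h Hh ->] Cc -> ->.
by exists c; rewrite //= rcosetE rcosetM (rcosetM _ h) (rcoset_id Hh).
Qed.

Lemma sum_card_dcosets G H C : H \subset G -> C \subset G ->
  \sum_(A in dcosets G H C) #|A| = #|G|.
Proof.
move=> sHG sCG; apply: esym; apply: card_partition; apply/and3P; split.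
- apply/eqP/setP=> y; apply/bigcupP/idP=> [[A AA Ay] | Gy].
    exact: subsetP (dcosets_sub sHG sCG AA) y Ay.
  by exists (H :* y * C); rewrite ?dcoset_refl ?mem_dcosets.
- apply/trivIsetP=> A B AA BB neq; apply/pred0P=> t /=.
  apply: contraNF neq => /andP[/(dcosets_eq AA)-> /(dcosets_eq BB)->].
  by [].
- by apply/negP=> /dcosets_neq0[x]; rewrite inE.
Qed.

Lemma coset_orbits_cover G H x (U : {set {set gT}}) : U \in coset_orbits G x H ->
  [/\ cover U \in dcosets G H <[x]>, U = rcosets H (cover U)
    & #|U| = #|cover U| %/ #|H|].
Proof.
case/imsetP=> _ /rcosetsP[g Gg ->]; rewrite orbit_rcoset => ->.
rewrite cover_rcosets_dcoset mem_dcosets //; split=> //.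
by rewrite -card_dcoset_orbit mulnK.
Qed.

Lemma rcosets_coset_orbits G H x A : A \in dcosets G H <[x]> ->
  rcosets H A \in coset_orbits G x H /\ cover (rcosets H A) = A.
Proof.
case/dcosetsP=> g Gg ->; rewrite cover_rcosets_dcoset; split=> //.
by apply/imsetP; exists (H :* g); rewrite ?orbit_rcoset //; apply/rcosetsP; exists g.
Qed.

Lemma dcosets_card_dvd G H C A : A \in dcosets G H C ->
  (#|A| %/ #|H| * #|H|)%N = #|A|.
Proof. by case/dcosetsP=> x _ ->; rewrite -card_dcoset_orbit mulnK. Qed.

(** The image of [W] under the natural map consists of the right cosets of [H] in [H * cover W], so
    lying over compares [H * cover W] with [cover U], and [dcosets_mul] turns this into
    inclusion. *)
Lemma lies_over_cover G H K x (U W : {set {set gT}}) :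
    K \subset H -> H \subset G ->
    U \in coset_orbits G x H -> W \in coset_orbits G x K ->
  lies_over H W U = (cover W \subset cover U).
Proof.
move=> sKH sHG UU WW.
have [cU eU _] := coset_orbits_cover UU; have [cW eW _] := coset_orbits_cover WW.
rewrite -(dcosets_mul sKH sHG cU cW) /lies_over.
have eI : [set (H * D : {set gT}) | D in W] = rcosets H (cover W).
  apply/setP=> D; apply/imsetP/rcosetsP=> [[E] | [z Wz ->]].
    by rewrite {1}eW => /rcosetsP[z Wz ->] ->; exists z; rewrite // mulgA mulGSid.
  exists (K :* z); rewrite ?mulgA ?mulGSid // eW.
  by apply/rcosetsP; exists z; rewrite -?eW.
have cE : cover (rcosets H (cover W)) = H * cover W.
  apply/setP=> y; apply/bigcupP/mulsgP=> [[_ /rcosetsP[z Wz ->]] | [h z Hh Wz ->]].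
    by case/rcosetP=> h Hh ->; exists h z.
  by exists (H :* z); [apply/rcosetsP; exists z | rewrite mem_mulg ?set11].
rewrite eI; apply/eqP/eqP=> [<- // | e]; rewrite [U]eU -e.
apply/setP=> D; apply/rcosetsP/rcosetsP=> [[z Wz ->] | [z Wz ->]].
  by exists z => //; apply: (subsetP (mulG_subr _ _)).
case/mulsgP: Wz => h t Hh Wt ->; exists t => //.
by rewrite rcosetM rcoset_id.
Qed.

End DoubleCosets.

(** * Division isomorphisms *)

Section Definitions.

Variables (gT1 gT2 : finGroupType) (G1 : {group gT1}) (G2 : {group gT2}).
Variables (s : {group gT1} -> {group gT2}) (t : {group gT2} -> {group gT1}).

(** The maps are total on groups of the ambient types but constrained only on subgroups of [G1] and
    [G2], so the same maps serve unchanged after restriction to a subgroup. *)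
Record subgroup_iso : Prop := SubgroupIso {
  siso_sub : forall H : {group gT1}, H \subset G1 -> s H \subset G2;
  siso_subV : forall H : {group gT2}, H \subset G2 -> t H \subset G1;
  sisoK : forall H : {group gT1}, H \subset G1 -> t (s H) = H;
  sisoKV : forall H : {group gT2}, H \subset G2 -> s (t H) = H;
  siso_mono : forall H K : {group gT1}, H \subset G1 -> K \subset G1 ->
    (s H \subset s K) = (H \subset K);
  siso_card : forall H : {group gT1}, H \subset G1 -> #|s H| = #|H|
}.

(* The C-orbits on H \ G1, for all H at once, are matched to the D-orbits on
   s H \ G2; an orbit is represented by its union, a double coset. *)
Record splitting_iso (C : {set gT1}) (D : {set gT2})
    (p : {group gT1} -> {set gT1} -> {set gT2}) : Prop := SplittingIso {
  spl_in : forall (H : {group gT1}) A, H \subset G1 -> A \in dcosets G1 H C ->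
    p H A \in dcosets G2 (s H) D;
  spl_onto : forall (H : {group gT1}) B, H \subset G1 ->
    B \in dcosets G2 (s H) D -> exists2 A, A \in dcosets G1 H C & p H A = B;
  spl_card : forall (H : {group gT1}) A, H \subset G1 -> A \in dcosets G1 H C ->
    #|p H A| = #|A|;
  spl_mono : forall (H K : {group gT1}) A B, H \subset G1 -> K \subset H ->
    A \in dcosets G1 H C -> B \in dcosets G1 K C ->
    (p K B \subset p H A) = (B \subset A)
}.

(* A splitting isomorphism is only defined up to right translation by the
   normaliser of s C; fixing the image of the coset C rigidifies it enough to
   be restricted to subgroups. *)
Record division_iso : Prop := DivisionIso {
  div_siso :> subgroup_iso;
  div_cyclic : forall C : {group gT1}, C \subset G1 -> cyclic C -> cyclic (s C);
  div_cyclicV : forall C : {group gT2}, C \subset G2 -> cyclic C -> cyclic (t C);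
  div_split : forall C : {group gT1}, C \subset G1 -> cyclic C ->
    exists2 p, splitting_iso C (s C) p & p C C = s C
}.

End Definitions.

(** * Subgroup lattice isomorphisms: inverses, meets, joins, restriction *)

Lemma subgroup_iso_sym (gT1 gT2 : finGroupType) (G1 : {group gT1})
    (G2 : {group gT2}) s t : subgroup_iso G1 G2 s t -> subgroup_iso G2 G1 t s.
Proof.
case=> sS sSV K KV mono card; split=> // [H K' sH sK|H sH].
  by rewrite -mono ?sSV // !KV.
by rewrite -card ?sSV // KV.
Qed.

Section SubgroupIso.

Variables (gT1 gT2 : finGroupType) (G1 : {group gT1}) (G2 : {group gT2}).
Variables (s : {group gT1} -> {group gT2}) (t : {group gT2} -> {group gT1}).
Hypothesis Hs : subgroup_iso G1 G2 s t.
Implicit Types H K L : {group gT1}.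

Lemma siso_inj H K : H \subset G1 -> K \subset G1 -> s H = s K -> H = K.
Proof. by move=> sH sK e; rewrite -(sisoK Hs sH) e (sisoK Hs). Qed.

Lemma siso_eq H K : H \subset G1 -> K \subset G1 -> (s H == s K) = (H == K).
Proof. by move=> sH sK; apply/eqP/eqP=> [/siso_inj->|->]. Qed.

Lemma siso1 : s 1%G = 1%G.
Proof. by apply/val_inj/card1_trivg; rewrite (siso_card Hs) ?sub1G ?cards1. Qed.

Lemma siso_full : s G1 = G2.
Proof.
apply/val_inj/eqP; rewrite eqEsubset (siso_sub Hs) //=.
by rewrite -{1}(sisoKV Hs (subxx G2)) (siso_mono Hs) // (siso_subV Hs).
Qed.

Lemma siso_proper H K : H \subset G1 -> K \subset G1 ->
  (s H \proper s K) = (H \proper K).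
Proof. by move=> sH sK; rewrite !properE !(siso_mono Hs). Qed.

(** Meets depend on the inclusion order alone: [t (s H :&: s K)] lies below both [H] and [K], which
    gives the inclusion that monotonicity of [s] does not show directly. *)
Lemma sisoI H K : H \subset G1 -> K \subset G1 -> s (H :&: K)%G = (s H :&: s K)%G.
Proof.
move=> sH sK; have sHK: H :&: K \subset G1 by rewrite subIset ?sH.
apply/val_inj/eqP; rewrite eqEsubset subsetI /= !(siso_mono Hs) //.
rewrite subsetIl subsetIr /=.
have sI : (s H :&: s K)%G \subset G2 by rewrite subIset ?(siso_sub Hs).
have eT : s (t (s H :&: s K)%G) = s H :&: s K :> {set _} by rewrite (sisoKV Hs).
have sT := siso_subV Hs sI.
rewrite -eT (siso_mono Hs) // subsetI.
by rewrite -(siso_mono Hs sT sH) -(siso_mono Hs sT sK) eT subsetIl subsetIr.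
Qed.

Lemma sisoY H K : H \subset G1 -> K \subset G1 -> s (H <*> K)%G = (s H <*> s K)%G.
Proof.
move=> sH sK; have sHK: H <*> K \subset G1 by rewrite join_subG sH.
apply/val_inj/eqP; rewrite eqEsubset andbC join_subG /= !(siso_mono Hs) //.
rewrite joing_subl joing_subr /=.
have sY : (s H <*> s K)%G \subset G2 by rewrite join_subG !(siso_sub Hs).
have eT : s (t (s H <*> s K)%G) = s H <*> s K :> {set _} by rewrite (sisoKV Hs).
have sT := siso_subV Hs sY.
rewrite -eT (siso_mono Hs) // join_subG.
by rewrite -(siso_mono Hs sH sT) -(siso_mono Hs sK sT) eT joing_subl joing_subr.
Qed.

Lemma siso_restrict H : H \subset G1 -> subgroup_iso H (s H) s t.
Proof.
move=> sHG; have sHG2 := siso_sub Hs sHG.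
split=> [K sK|K sK|K sK|K sK|K L sK sL|K sK].
- by rewrite (siso_mono Hs) // (subset_trans sK).
- have sK2 := subset_trans sK sHG2.
  by rewrite -(siso_mono Hs) ?(siso_subV Hs) // (sisoKV Hs).
- by rewrite (sisoK Hs) // (subset_trans sK).
- by rewrite (sisoKV Hs) // (subset_trans sK).
- by rewrite (siso_mono Hs) // ?(subset_trans sK) ?(subset_trans sL).
- by rewrite (siso_card Hs) // (subset_trans sK).
Qed.

End SubgroupIso.

(** * Splitting isomorphisms: translation, base points, inverses *)

Section SplittingIso.

Variables (gT1 gT2 : finGroupType) (G1 : {group gT1}) (G2 : {group gT2}).
Variables (s : {group gT1} -> {group gT2}) (t : {group gT2} -> {group gT1}).
Hypothesis Hs : subgroup_iso G1 G2 s t.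
Implicit Types (H K L C : {group gT1}) (D : {group gT2}).

Lemma spl_inj C D p H A B : splitting_iso G1 G2 s C D p -> H \subset G1 ->
  A \in dcosets G1 H C -> B \in dcosets G1 H C -> p H A = p H B -> A = B.
Proof.
move=> Hp sH AA BB e; apply: (dcosets_inj AA BB).
by rewrite -(spl_mono Hp sH (subxx H)) // e.
Qed.

(** By [dcosets_card1], a conjugate of the acting group lies in [H] exactly when some double coset
    of [H] has size [#|H|], and the sizes compared are preserved by [p] and [s]. *)
Lemma spl_conj_sub C D p H : splitting_iso G1 G2 s C D p ->
    C \subset G1 -> D \subset G2 -> H \subset G1 ->
  (exists2 x, x \in G1 & C :^ x \subset H) <->
  (exists2 y, y \in G2 & D :^ y \subset s H).
Proof.
move=> Hp sC sD sH; have sH2 := siso_sub Hs sH.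
split=> [/(dcosets_card1 sH sC)/existsP[A /andP[AA /eqP cA]] |].
  apply/(dcosets_card1 sH2 sD)/existsP; exists (p H A).
  by rewrite (spl_in Hp) //= (spl_card Hp) // cA (siso_card Hs).
case/(dcosets_card1 sH2 sD)/existsP=> B /andP[/(spl_onto Hp sH)[A AA <-]].
rewrite (spl_card Hp) // (siso_card Hs) // => cA.
by apply/(dcosets_card1 sH sC)/existsP; exists A; rewrite AA.
Qed.

(* Since D lies in s (t D) = D, the group t D contains a conjugate of C, whence
   #|C| <= #|D|. *)
Lemma spl_conj C D p : splitting_iso G1 G2 s C D p ->
    C \subset G1 -> D \subset G2 -> exists2 y, y \in G2 & s C :=: D :^ y.
Proof.
move=> Hp sC sD.
have [y Gy sDy]: exists2 y, y \in G2 & D :^ y \subset s C.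
  by apply/(spl_conj_sub Hp sC sD sC); exists 1; rewrite ?conjsg1.
exists y => //; apply/eqP; rewrite eq_sym eqEcard sDy cardJg (siso_card Hs) //.
have sT := siso_subV Hs sD.
have [x Gx sCx]: exists2 x, x \in G1 & C :^ x \subset t D.
  by apply/(spl_conj_sub Hp sC sD sT); exists 1; rewrite ?conjsg1 ?(sisoKV Hs).
by rewrite -(cardJg C x) -{1}(sisoKV Hs sD) (siso_card Hs) ?subset_leq_card.
Qed.

Lemma splJr C D p g : g \in G2 ->
  splitting_iso G1 G2 s C D p ->
  splitting_iso G1 G2 s C (D :^ g) (fun H A => p H A :* g).
Proof.
move=> Gg Hp; split=> [H A sH AA|H B sH BB|H A sH AA|H K A B sH sK AA BB].
- by apply: dcosetsJ => //; apply: (spl_in Hp).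
- have: B :* g^-1 \in dcosets G2 (s H) ((D :^ g) :^ g^-1).
    by apply: dcosetsJ; rewrite ?groupV.
  rewrite /= conjsgK => /(spl_onto Hp sH)[A AA e]; exists A => //.
  by rewrite e -mulgA mulg_set1 mulVg mulg1.
- by rewrite card_rcoset (spl_card Hp).
- by rewrite rcosetS (spl_mono Hp).
Qed.

Lemma splJl C D p g : g \in G1 ->
  splitting_iso G1 G2 s C D p ->
  splitting_iso G1 G2 s (C :^ g) D (fun H A => p H (A :* g^-1)).
Proof.
move=> Gg Hp.
have inJ H A : A \in dcosets G1 H (C :^ g) -> A :* g^-1 \in dcosets G1 H C.
  by move=> AA; have := dcosetsJ (groupVr Gg) AA; rewrite /= conjsgK.
split=> [H A sH AA|H B sH BB|H A sH AA|H K A B sH sK AA BB].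
- by apply: (spl_in Hp) => //; apply: inJ.
- have [A AA <-] := spl_onto Hp sH BB; exists (A :* g); first exact: dcosetsJ.
  by rewrite -mulgA mulg_set1 mulgV mulg1.
- by rewrite (spl_card Hp) ?inJ // card_rcoset.
- by rewrite (spl_mono Hp) ?inJ // rcosetS.
Qed.

(** First [D] is conjugated to [s C]. Then [p C C] is a double coset of size [#|s C|], hence
    [s C :* g] with [g] normalizing [s C], and translating by [g^-1] moves it to [s C] without
    changing the acting group. *)
Lemma spl_point C D p : splitting_iso G1 G2 s C D p ->
    C \subset G1 -> D \subset G2 ->
  exists2 p', splitting_iso G1 G2 s C (s C) p' & p' C C = s C.
Proof.
move=> Hp sC sD; have [y Gy eC] := spl_conj Hp sC sD.
have {Hp} := splJr Gy Hp; rewrite -eC.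
move: (fun _ _ => _) => {}p Hp; have sC2 := siso_sub Hs sC.
have CC := dcosets_id G1 (subxx C).
have /dcosetsP[g Gg e] := spl_in Hp sC CC.
have: #|s C :* g * s C| == #|s C| by rewrite -e (spl_card Hp) // (siso_card Hs).
rewrite dcoset_card => sCg.
have nCg: g \in 'N(s C) by rewrite -groupV inE.
exists (fun H A => p H A :* g^-1).
  have := splJr (groupVr Gg) Hp.
  by rewrite /= (normP _) // groupV.
rewrite e -(mulgA (s C)) -(norm_rlcoset nCg) mulgA mulGid -mulgA mulg_set1.
by rewrite mulgV mulg1.
Qed.

(** Monotonicity puts [p C C], hence 1, inside [p H H], and the double coset of [s H] and [s C]
    through 1 is [s H]. *)
Lemma spl_fix C p H : splitting_iso G1 G2 s C (s C) p -> p C C = s C ->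
  H \subset G1 -> C \subset H -> p H H = s H.
Proof.
move=> Hp pC sH sCH; have sC := subset_trans sCH sH.
have HH := dcosets_id G1 sCH; have CC := dcosets_id G1 (subxx C).
have sC2 : s C \subset s H by rewrite (siso_mono Hs).
have p1 : 1 \in p H H.
  have /subsetP: p C C \subset p H H by rewrite (spl_mono Hp).
  by rewrite pC; apply.
by rewrite (dcosets_eq (spl_in Hp sH HH) p1) mulg1 mulGSid.
Qed.

End SplittingIso.

Section DivisionIsoSym.

Variables (gT1 gT2 : finGroupType) (G1 : {group gT1}) (G2 : {group gT2}).
Variables (s : {group gT1} -> {group gT2}) (t : {group gT2} -> {group gT1}).

Lemma spl_sym (C : {group gT1}) (D : {group gT2}) p :
    subgroup_iso G1 G2 s t -> splitting_iso G1 G2 s C D p ->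
  exists2 q, splitting_iso G2 G1 t D C q &
    forall (H : {group gT1}) A, H \subset G1 -> A \in dcosets G1 H C ->
      q (s H) (p H A) = A.
Proof.
move=> Hs Hp.
pose P (H : {group gT2}) B A := (A \in dcosets G1 (t H) C) && (p (t H) A == B).
(* Choice of a preimage under [p]; the default [set0] is excluded on double cosets by [spl_onto]. *)
pose q H B := odflt set0 [pick A | P H B A].
have qP (H : {group gT2}) B : H \subset G2 -> B \in dcosets G2 H D ->
    q H B \in dcosets G1 (t H) C /\ p (t H) (q H B) = B.
  move=> sH; rewrite -{1}(sisoKV Hs sH) => /(spl_onto Hp (siso_subV Hs sH))[A AA e].
  rewrite /q; case: pickP => [A' /andP[? /eqP] // | /(_ A)].
  by rewrite /P AA e eqxx.
have qK (H : {group gT1}) A : H \subset G1 -> A \in dcosets G1 H C ->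
    q (s H) (p H A) = A.
  move=> sH AA; have [] := qP (s H) (p H A); rewrite ?(siso_sub Hs) ?(spl_in Hp) //.
  by rewrite (sisoK Hs) // => ? /(spl_inj Hp sH); apply.
exists q => //.
split=> [H A sH AA|H B sH BB|H A sH AA|H K A B sH sK AA BB].
- by case: (qP H A).
- have sT := siso_subV Hs sH; exists (p (t H) B).
    by have:= spl_in Hp sT BB; rewrite (sisoKV Hs).
  by rewrite -{1}(sisoKV Hs sH) qK.
- have [qA {2}<-] := qP H A sH AA; by rewrite (spl_card Hp) ?(siso_subV Hs).
- have [qA {2}<-] := qP H A sH AA.
  have [qB {2}<-] := qP K B (subset_trans sK sH) BB.
  rewrite (spl_mono Hp) ?(siso_subV Hs) //.
  by rewrite -(siso_mono Hs) ?(siso_subV Hs) ?(sisoKV Hs) // (subset_trans sK).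
Qed.

End DivisionIsoSym.

Lemma division_iso_sym (gT1 gT2 : finGroupType) (G1 : {group gT1})
    (G2 : {group gT2}) s t : division_iso G1 G2 s t -> division_iso G2 G1 t s.
Proof.
case=> Hs cyc cycV spl; split=> // [|C sC cC]; first exact: subgroup_iso_sym.
have sT := siso_subV Hs sC.
have [p Hp pC] := spl _ sT (cycV C sC cC).
have [q Hq qK] := spl_sym Hs Hp; exists q; first by rewrite -{1}(sisoKV Hs sC).
have:= qK _ _ sT (dcosets_id G1 (subxx _)).
by rewrite pC (sisoKV Hs).
Qed.

(** * Restriction to subgroups, normality and conjugacy *)

Section DivisionIso.

Variables (gT1 gT2 : finGroupType) (G1 : {group gT1}) (G2 : {group gT2}).
Variables (s : {group gT1} -> {group gT2}) (t : {group gT2} -> {group gT1}).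
Hypothesis Ds : division_iso G1 G2 s t.
Let Hs : subgroup_iso G1 G2 s t := Ds.
Implicit Types H K L C : {group gT1}.

(** Since [p H H = s H] by [spl_fix], monotonicity makes [p] send the double cosets inside [H] onto
    those inside [s H]. *)
Lemma div_restrict H : H \subset G1 -> division_iso H (s H) s t.
Proof.
move=> sHG; have sHG2 := siso_sub Hs sHG.
split=> [|C sC|C sC|C sC cC]; first exact: siso_restrict Hs _ sHG.
- by apply: (div_cyclic Ds); apply: subset_trans sHG.
- by apply: (div_cyclicV Ds); apply: subset_trans sHG2.
have sCG := subset_trans sC sHG; have [p Hp pC] := div_split Ds sCG cC.
have pH := spl_fix Hs Hp pC sHG sC.
have HH := dcosets_id G1 sC.
have sC2 : s C \subset s H by rewrite (siso_mono Hs).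
exists p => //; split=> [K A sK|K B sK|K A sK|K L A B sK sL].
- have sKG := subset_trans sK sHG.
  rewrite (dcosets_subgroup _ sHG) // (dcosets_subgroup _ sHG2) ?(siso_mono Hs) //.
  case/andP=> AA sA.
  by rewrite (spl_in Hp) //= -pH (spl_mono Hp).
- have sKG := subset_trans sK sHG.
  rewrite (dcosets_subgroup _ sHG2) ?(siso_mono Hs) //.
  case/andP=> /(spl_onto Hp sKG)[A AA <-].
  rewrite -pH (spl_mono Hp) // => sA.
  by exists A; rewrite // (dcosets_subgroup A sHG) ?AA.
- have sKG := subset_trans sK sHG.
  by rewrite (dcosets_subgroup A sHG) // => /andP[AA sA]; apply: (spl_card Hp).
have sKG := subset_trans sK sHG.
rewrite (dcosets_subgroup A sHG) // (dcosets_subgroup B sHG) ?(subset_trans sL) //.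
by case/andP=> AA _ /andP[BB _]; apply: (spl_mono Hp).
Qed.

(** For [y] in [s H] the cyclic group [t <[y]>] lies in [H], so normality gives each of its double
    cosets with [H] the size [#|H|]. The matching carries this size to [s H :* g * <[y]>], which
    says that the conjugate of [y] by [g^-1] stays in [s H]. *)
Lemma div_normal_imp H : H \subset G1 -> H <| G1 -> s H <| G2.
Proof.
move=> sH /andP[_ nH]; rewrite /normal (siso_sub Hs) //=.
apply/subsetP=> g Gg; rewrite -groupV inE; apply/subsetP=> _ /imsetP[y Hy ->].
have sC : <[y]> \subset G2 by rewrite cycle_subG (subsetP (siso_sub Hs sH)).
have sT := siso_subV Hs sC; have cT := div_cyclicV Ds sC (cycle_cyclic y).
have [p Hp _] := div_split Ds sT cT; rewrite (sisoKV Hs sC) in Hp.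
have sCH : t <[y]>%G \subset H.
  by rewrite -(siso_mono Hs) // (sisoKV Hs) // cycle_subG.
have BB : s H :* g * <[y]> \in dcosets G2 (s H) <[y]> by apply: mem_dcosets.
have [A /dcosetsP[x Gx eA] e] := spl_onto Hp sH BB.
have: #|A| == #|H|.
  by rewrite eA dcoset_card -(normsP nH x^-1) ?groupV // conjSg.
have ->: #|A| = #|s H :* g * <[y]>|.
  by rewrite -e (spl_card Hp) // eA mem_dcosets.
rewrite -(siso_card Hs sH) dcoset_card => /subsetP; apply.
by rewrite memJ_conjg cycle_id.
Qed.

(** For groups of equal order, being conjugate amounts to containing a conjugate, which
    [spl_conj_sub] detects. *)
Lemma div_conj_imp C1 C2 : C1 \subset G1 -> C2 \subset G1 -> cyclic C1 ->
  (exists2 x, x \in G1 & C2 :=: C1 :^ x) ->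
  exists2 y, y \in G2 & s C2 :=: s C1 :^ y.
Proof.
move=> sC1 sC2 cC1 [x Gx e]; have [p Hp _] := div_split Ds sC1 cC1.
have [|y Gy sC] := (spl_conj_sub Hs Hp sC1 (siso_sub Hs sC1) sC2).1.
  by exists x; rewrite // e.
exists y => //; apply/eqP; rewrite eq_sym eqEcard sC.
by rewrite cardJg !(siso_card Hs) // e cardJg leqnn.
Qed.

End DivisionIso.

(** * Quotients and isomorphic groups *)

Section QuotientDoubleCosets.

Variables (gT : finGroupType) (G N : {group gT}).
Hypothesis nsNG : N <| G.
Implicit Types (H K C : {group gT}) (A B : {set gT}).

Lemma quotient_dcoset_pre H C A : H \subset G -> C \subset G -> N \subset H ->
  A \in dcosets G H C -> coset N @*^-1 (A / N) = A.
Proof.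
move=> sHG sCG sNH AA; rewrite quotientK.
  by case/dcosetsP: AA => x _ ->; rewrite dcoset_stable.
by rewrite (subset_trans (dcosets_sub sHG sCG AA)) ?normal_norm.
Qed.

Lemma quotient_dcosets H C A : H \subset G ->
  A \in dcosets G H C -> A / N \in dcosets (G / N) (H / N) (C / N).
Proof.
move=> sHG /dcosetsP[x Gx ->]; have nNG := normal_norm nsNG.
have nNx := subsetP nNG x Gx; have nNH := subset_trans sHG nNG.
rewrite !quotientMl ?quotient_set1 ?mul_subG ?sub1set //.
by apply: mem_dcosets; apply: mem_quotient.
Qed.

Lemma cosetpre_dcosets (K : {group coset_of N}) C (A : {set coset_of N}) :
    C \subset G -> K \subset G / N -> A \in dcosets (G / N) K (C / N) ->
  coset N @*^-1 A \in dcosets G (coset N @*^-1 K) C.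
Proof.
move=> sCG sKG /dcosetsP[_ /morphimP[x nNx Gx ->] eA].
have sPG : coset N @*^-1 K \subset G by rewrite sub_cosetpre_quo.
have AA := mem_dcosets (coset N @*^-1 K)%G C Gx.
suff -> : A = (coset N @*^-1 K :* x * C) / N.
  by rewrite (quotient_dcoset_pre _ sCG _ AA) //= sub_cosetpre.
have nNG := normal_norm nsNG.
rewrite !quotientMl ?mul_subG ?sub1set ?(subset_trans sPG) //.
by rewrite quotient_set1 // cosetpreK.
Qed.

Lemma card_quotient_dcoset H C A : H \subset G -> C \subset G -> N \subset H ->
  A \in dcosets G H C -> (#|A / N| * #|N|)%N = #|A|.
Proof.
move=> sHG sCG sNH AA; rewrite card_quotient; last first.
  by rewrite (subset_trans (dcosets_sub sHG sCG AA)) ?normal_norm.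
apply: card_rcosets_stable.
by case/dcosetsP: AA => x _ ->; rewrite dcoset_stable.
Qed.

End QuotientDoubleCosets.

(** The map induced through the correspondence theorem. [M] is kept separate from [s N] so that the
    inverse, built from [t], lands in the quotient by [N] rather than by [t (s N)]. *)
Definition quotient_map (gT1 gT2 : finGroupType) (s : {group gT1} -> {group gT2})
    (N : {group gT1}) (M : {group gT2}) (K : {group coset_of N}) :
  {group coset_of M} := (s (coset N @*^-1 K)%G / M)%G.

Lemma quotient_mapE (gT1 gT2 : finGroupType) (s : {group gT1} -> {group gT2})
    (N L : {group gT1}) (M : {group gT2}) :
  N <| L -> quotient_map s M (L / N)%G = (s L / M)%G.
Proof.
move=> nsN; rewrite /quotient_map.
suff -> : (coset N @*^-1 (L / N))%G = L by [].
by apply/val_inj; rewrite /= quotientGK.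
Qed.

Section QuotientIso.

Variables (gT1 gT2 : finGroupType) (G1 : {group gT1}) (G2 : {group gT2}).
Variables (s : {group gT1} -> {group gT2}) (t : {group gT2} -> {group gT1}).
Hypothesis Hs : subgroup_iso G1 G2 s t.
Variable N : {group gT1}.
Hypotheses (nsN : N <| G1) (nsM : s N <| G2).
Let M := s N.
Local Notation sQ := (@quotient_map _ _ s N M).
Local Notation tQ := (@quotient_map _ _ t M N).
Implicit Types H K L C : {group gT1}.

Let sNG : N \subset G1 := normal_sub nsN.

Lemma quo_pre (K : {group coset_of N}) : K \subset G1 / N ->
  [/\ (coset N @*^-1 K)%G \subset G1, M <| s (coset N @*^-1 K)%G
    & (coset M @*^-1 (sQ K))%G = s (coset N @*^-1 K)%G].
Proof.
move=> sK; have sP : (coset N @*^-1 K)%G \subset G1 by rewrite /= sub_cosetpre_quo.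
have nM : M <| s (coset N @*^-1 K)%G.
  apply: normalS nsM; last exact: (siso_sub Hs).
  by rewrite (siso_mono Hs) //= sub_cosetpre.
by split=> //; apply/val_inj; rewrite /= quotientGK.
Qed.

End QuotientIso.

Section QuotientDivisionIso.

Variables (gT1 gT2 : finGroupType) (G1 : {group gT1}) (G2 : {group gT2}).
Variables (s : {group gT1} -> {group gT2}) (t : {group gT2} -> {group gT1}).

Lemma quo_siso (N : {group gT1}) : subgroup_iso G1 G2 s t ->
    N <| G1 -> s N <| G2 ->
  subgroup_iso (G1 / N) (G2 / s N)
    (@quotient_map _ _ s N (s N)) (@quotient_map _ _ t (s N) N).
Proof.
move=> Hs nsN nsM; have sNG := normal_sub nsN.
have Hs' := subgroup_iso_sym Hs.
have tN : t (s N) = N by rewrite (sisoK Hs).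
have preS := quo_pre Hs nsN nsM.
have preT := quo_pre Hs' nsM; rewrite tN in preT; have {}preT := preT nsN.
split=> [K sK|K sK|K sK|K sK|K L sK sL|K sK].
- by have [sP _ _] := preS K sK; rewrite quotientS // (siso_sub Hs).
- by have [sP _ _] := preT K sK; rewrite quotientS // (siso_subV Hs).
- have [sP _ e] := preS K sK; apply/val_inj.
  by rewrite /quotient_map e (sisoK Hs) //= cosetpreK.
- have [sP _ e] := preT K sK; apply/val_inj.
  by rewrite /quotient_map e (sisoKV Hs) //= cosetpreK.
- have [sP nP _] := preS K sK; have [sP' nP' _] := preS L sL.
  rewrite (quotientSGK (normal_norm nP) (normal_sub nP')).
  by rewrite (siso_mono Hs) // cosetpreSK.
- have [sP nP _] := preS K sK.
  by rewrite card_quotient ?normal_norm // -divgS ?normal_sub // !(siso_card Hs) //=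
     card_cosetpre mulKn.
Qed.

(** A cyclic subgroup of the quotient lifts to a cyclic [C]; the matching for [C] is applied between
    taking a preimage and taking a quotient, and sizes change by the common factor
    [#|N| = #|s N|]. *)
Lemma quo_div_iso (N : {group gT1}) : division_iso G1 G2 s t ->
    N <| G1 -> s N <| G2 ->
  division_iso (G1 / N) (G2 / s N)
    (@quotient_map _ _ s N (s N)) (@quotient_map _ _ t (s N) N).
Proof.
move=> Ds nsN nsM; have Hs : subgroup_iso G1 G2 s t := Ds.
have sNG := normal_sub nsN; have sMG := normal_sub nsM.
have preS := quo_pre Hs nsN nsM; have HQ := quo_siso Hs nsN nsM.
(* For [C] not containing [N], the induced map is computed through [C <*> N], whose image is
   [s C <*> s N]. *)
have mapE (C : {group gT1}) : C \subset G1 ->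
    quotient_map s (s N) (C / N)%G = (s C / s N)%G.
  move=> sC; have nNC := subset_trans sC (normal_norm nsN).
  have nMC := subset_trans (siso_sub Hs sC) (normal_norm nsM).
  have <- : (C <*> N / N)%G = (C / N)%G by apply/val_inj; rewrite /= quotientYidr.
  rewrite quotient_mapE /= ?normalYr //.
  by rewrite (sisoY Hs) //; apply/val_inj; rewrite /= quotientYidr.
have mapEV (D : {group gT2}) : D \subset G2 ->
    quotient_map t N (D / s N)%G = (t D / N)%G.
  move=> sD; have sT := siso_subV Hs sD.
  by rewrite -{1}(sisoKV Hs sD) -mapE // (sisoK HQ) ?quotientS.
have lift (gT : finGroupType) (G P C : {group gT}) (C' : {group coset_of P}) :
    P <| G -> C' \subset G / P -> cyclic C' ->
    exists2 D : {group gT}, D \subset G & cyclic D /\ C' = (D / P)%G.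
  move=> nsP sC' /cyclicP[y eC].
  have: y \in G / P by rewrite (subsetP sC') // eC cycle_id.
  case/morphimP=> x nPx Gx ey; exists <[x]>%G; first by rewrite cycle_subG.
  by split; [exact: cycle_cyclic | apply/val_inj; rewrite /= eC ey quotient_cycle].
split=> // [C' sC' cC'|C' sC' cC'|C' sC' cC'].
- have [C sC [cC ->]] := lift _ _ _ N C' nsN sC' cC'.
  by rewrite mapE // quotient_cyclic // (div_cyclic Ds).
- have [C sC [cC ->]] := lift _ _ _ (s N) C' nsM sC' cC'.
  by rewrite mapEV // quotient_cyclic // (div_cyclicV Ds).
have [C sC [cC ->]] := lift _ _ _ N C' nsN sC' cC'.
have [p Hp pC] := div_split Ds sC cC; have sC2 := siso_sub Hs sC.
rewrite mapE //.
pose q (K : {group coset_of N}) (A : {set coset_of N}) :=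
  p (coset N @*^-1 K)%G (coset N @*^-1 A) / s N.
(* Base point: the preimage of [C / N] is [C <*> N], which contains [C], so [spl_fix] determines its
   image. *)
exists q; last first.
  have sY : C <*> N \subset G1 by rewrite join_subG sC.
  have e : (coset N @*^-1 (C / N))%G = (C <*> N)%G.
    apply/val_inj; rewrite /= quotientYK 1?joingC //.
    by rewrite (subset_trans sC) ?normal_norm.
  rewrite /q e -[coset N @*^-1 _]/(gval (coset N @*^-1 (C / N))%G) e.
  rewrite (spl_fix Hs Hp pC) ?joing_subl // (sisoY Hs) //= quotientYidr //.
  by rewrite (subset_trans sC2) ?normal_norm.
have pre_in (K : {group coset_of N}) (A : {set coset_of N}) :
    K \subset G1 / N -> A \in dcosets (G1 / N) K (C / N) ->
    coset N @*^-1 A \in dcosets G1 (coset N @*^-1 K) C.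
  exact: cosetpre_dcosets.
split=> [K A sK AA|K B sK BB|K A sK AA|H K A B sH sK AA BB].
- have [sP nP _] := preS K sK.
  apply: quotient_dcosets; rewrite ?(siso_sub Hs) //.
  by apply: (spl_in Hp); rewrite ?pre_in.
- have [sP nP e] := preS K sK.
  have := cosetpre_dcosets nsM sC2 (siso_sub HQ sK) BB.
  rewrite -[coset _ @*^-1 (quotient_map _ _ _)]/(gval
    (coset _ @*^-1 (quotient_map s _ K))%G) e.
  case/(spl_onto Hp sP)=> A AA eA; exists (A / N).
    by have := quotient_dcosets nsN sP AA; rewrite /= cosetpreK.
  by rewrite /q (quotient_dcoset_pre nsN sP sC) ?sub_cosetpre // eA cosetpreK.
- have [sP nP e] := preS K sK; have AA' := pre_in K A sK AA.
  apply/eqP; rewrite -(eqn_pmul2r (cardG_gt0 (s N))).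
  rewrite (card_quotient_dcoset nsM (siso_sub Hs sP) sC2 (normal_sub nP));
    last exact: (spl_in Hp).
  rewrite (spl_card Hp) // (siso_card Hs sNG) -{2}(cosetpreK A).
  by rewrite (card_quotient_dcoset nsN sP sC) ?sub_cosetpre.
have sK1 := subset_trans sK sH.
have [sP nP _] := preS H sH; have [sP' nP' _] := preS K sK1.
have AA' := pre_in H A sH AA; have BB' := pre_in K B sK1 BB.
have pA := spl_in Hp sP AA'; have pB := spl_in Hp sP' BB'.
have eA := quotient_dcoset_pre nsM (siso_sub Hs sP) sC2 (normal_sub nP) pA.
have eB := quotient_dcoset_pre nsM (siso_sub Hs sP') sC2 (normal_sub nP') pB.
by rewrite -cosetpreSK eA eB (spl_mono Hp) ?cosetpreSK.
Qed.

End QuotientDivisionIso.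

(** Jordan-Hoelder identifies composition factors only up to isomorphism, so isomorphic groups must
    be seen to have isomorphic division graphs. *)
Lemma isom_div_iso (gT1 gT2 : finGroupType) (G1 : {group gT1}) (G2 : {group gT2})
    (f : {morphism G1 >-> gT2}) : 'injm f -> f @* G1 = G2 ->
  division_iso G1 G2 (fun H => f @* H)%G (fun K => f @*^-1 K)%G.
Proof.
move=> injf fG.
have sV (K : {group gT2}) : K \subset G2 -> f @* (f @*^-1 K) = K.
  by move=> sK; rewrite morphpreK // fG.
split=> [|C sC cC|C sC cC|C sC cC].
- split=> [H sH|H sH|H sH|H sH|H K sH sK|H sH] /=.
  + by rewrite -fG morphimS.
  + exact: subsetIl.
  + by apply/val_inj; rewrite /= injmK.
  + by apply/val_inj; rewrite /= sV.
  + by rewrite injmSK.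
  + by rewrite card_injm.
- exact: morphim_cyclic.
- by rewrite -(injm_cyclic injf) /= ?sV // subsetIl.
exists (fun _ A => f @* A) => //.
have fdc (H : {group gT1}) x : H \subset G1 -> x \in G1 ->
    f @* (H :* x * C) = f @* H :* f x * f @* C.
  by move=> sH Gx; rewrite !morphimMl ?mul_subG ?sub1set // morphim_set1.
split=> [H A sH /dcosetsP[x Gx ->]|H B sH|H A sH AA|H K A B sH sK AA BB].
- by rewrite fdc // mem_dcosets // -fG mem_morphim.
- case/dcosetsP=> y; rewrite -{1}fG => /morphimP[x _ Gx ->] ->.
  by exists (H :* x * C); rewrite ?mem_dcosets ?fdc.
- by rewrite card_injm // (dcosets_sub sH sC AA).
- by rewrite injmSK // (dcosets_sub _ sC BB) // (subset_trans sK).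
Qed.

(** * Vertices of the division graph as double cosets *)

Section DivisionGraph.

Variables (gT : finGroupType) (G : {group gT}).
Local Notation divT := {d : {set gT} | d \in divisions G}.
Implicit Types (d : divT) (u v : division_graph G) (x y : gT).

Lemma same_divisionP x y :
  reflect (exists2 g, g \in G & <[y]> = <[x]> :^ g) (same_division G x y).
Proof.
by apply: (iffP exists_inP) => [[g Gg /eqP e]|[g Gg e]]; exists g; rewrite ?e.
Qed.

Lemma same_division_equiv : {in G & &, equivalence_rel (same_division G)}.
Proof.
move=> x y z _ _ _; split.
  by apply/same_divisionP; exists 1; rewrite ?group1 ?conjsg1.
case/same_divisionP=> g Gg exy.
apply/same_divisionP/same_divisionP=> [[h Gh exz]|[h Gh eyz]].
  by exists (g^-1 * h); rewrite ?groupM ?groupV // exy conjsgM conjsgK.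
by exists (g * h); rewrite ?groupM // conjsgM -exy.
Qed.

Lemma divisions_partition : partition (divisions G) G.
Proof. exact: equivalence_partitionP same_division_equiv. Qed.

Lemma division_repr_mem d : repr (val d) \in val d.
Proof.
case/and3P: divisions_partition => _ _ n0.
have [e|[x dx]] := set_0Vmem (val d); last exact: mem_repr dx.
by rewrite -e (valP d) in n0.
Qed.

Lemma division_sub d : val d \subset G.
Proof.
case/and3P: divisions_partition => /eqP eG _ _.
by rewrite -eG (bigcup_max (val d)) ?(valP d).
Qed.

Lemma division_repr_in d : repr (val d) \in G.
Proof. exact: subsetP (division_sub d) _ (division_repr_mem d). Qed.

Lemma division_mem d y : reflect
  (y \in G /\ exists2 g, g \in G & <[y]> = <[repr (val d)]> :^ g) (y \in val d).
Proof.
have /and3P[_ tP _] := divisions_partition.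
have eB := def_pblock tP (valP d) (division_repr_mem d).
have eR : y \in G -> (y \in val d) = same_division G (repr (val d)) y.
  move=> Gy; rewrite -{1}eB.
  by rewrite (pblock_equivalence_partition same_division_equiv) ?division_repr_in.
apply: (iffP idP) => [dy|[Gy /same_divisionP]]; last by rewrite eR.
have Gy := subsetP (division_sub d) y dy.
by split=> //; apply/same_divisionP; rewrite -eR.
Qed.

Lemma division_exists x : x \in G -> exists d, x \in val d.
Proof.
move=> Gx; have /and3P[/eqP eG _ _] := divisions_partition.
have: x \in cover (divisions G) by rewrite eG.
by case/bigcupP=> d dd dx; exists (exist _ d dd).
Qed.

Lemma division_eq d1 d2 x : x \in val d1 -> x \in val d2 -> d1 = d2.
Proof.
have /and3P[_ tP _] := divisions_partition => x1 x2; apply/val_inj.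
by rewrite -(def_pblock tP (valP d1) x1) (def_pblock tP (valP d2) x2).
Qed.

Lemma division_eq_conj d1 d2 :
    (exists2 g, g \in G & <[repr (val d2)]> = <[repr (val d1)]> :^ g) ->
  d1 = d2.
Proof.
move=> e; apply: (@division_eq _ _ (repr (val d2))); last exact: division_repr_mem.
by apply/division_mem; split=> //; apply: division_repr_in.
Qed.

(** A vertex is handled as the triple of its component, its colour and the union of its orbit;
    [vertex_exists] and [vertex_inj] allow the dependent pairs of the definition to be forgotten. *)
Definition vdiv v : divT := tag v.
Definition vsub v : subgroup_of G := colour v.
Definition vset v : {set gT} := cover (val (tagged v)).2.

Lemma vsub_sub v : vsub v \subset G.
Proof. exact: (valP (vsub v)). Qed.

Lemma vset_in v : vset v \in dcosets G (vsub v) <[repr (val (vdiv v))]>.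
Proof.
rewrite /vset /vsub; case: v => d [[H U] /= UU].
by have [] := coset_orbits_cover UU.
Qed.

Lemma vertex_exists d (H : subgroup_of G) A :
  A \in dcosets G H <[repr (val d)]> ->
  exists v, [/\ vdiv v = d, vsub v = H & vset v = A].
Proof.
case/rcosets_coset_orbits=> UU e.
by exists (Tagged (fun d => vertex (splitting_graph G (repr (val d))))
  (exist (fun v : subgroup_of G * {set {set gT}} =>
     v.2 \in coset_orbits G (repr (val d)) v.1) (H, rcosets H A) UU)).
Qed.

Lemma vertex_inj u v : vdiv u = vdiv v -> vsub u = vsub v -> vset u = vset v ->
  u = v.
Proof.
case: u v => d [[H U] /= UU] [d' [[K W] /= WW]]; rewrite /vdiv /vsub /vset /= => e.
case: d' / e in WW *; rewrite /= => e; case: K / e in WW *; rewrite /= => e.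
have [_ eU _] := coset_orbits_cover UU; have [_ eW _] := coset_orbits_cover WW.
by congr (Tagged _ _); apply/val_inj; rewrite /= eU eW e.
Qed.

Lemma division_arcE u v :
  arc u v = if [&& vdiv u == vdiv v, maximal (vsub v) (vsub u) &
                   vset v \subset vset u]
            then Some ((#|vset v| %/ #|vsub v|) %/ (#|vset u| %/ #|vsub u|))%N
            else None.
Proof.
rewrite /vdiv /vsub /vset; case: u v => d [[H U] /= UU] [d' [[K W] /= WW]].
rewrite /=; case: eqP => // e; case: d' / e in WW *; rewrite tagged_asE /=.
case: (boolP (maximal K H)) => //= maxK.
have sKH : K \subset H by have /maxgroupp/proper_sub := maxK.
rewrite (lies_over_cover sKH (valP H) UU WW).
have [_ _ ->] := coset_orbits_cover UU; have [_ _ ->] := coset_orbits_cover WW.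
by [].
Qed.

End DivisionGraph.

(** * Division isomorphisms induce graph isomorphisms *)

Lemma siso_maximal_imp (gT1 gT2 : finGroupType) (G1 : {group gT1})
    (G2 : {group gT2}) s t (H K : {group gT1}) : subgroup_iso G1 G2 s t ->
  H \subset G1 -> K \subset G1 -> maximal K H -> maximal (s K) (s H).
Proof.
move=> Hs sH sK /maxgroupP[pK maxK]; apply/maxgroupP.
split=> [|L pL sL]; first by rewrite (siso_proper Hs).
have sL2 := subset_trans (proper_sub pL) (siso_sub Hs sH).
have sT := siso_subV Hs sL2.
rewrite -(sisoKV Hs sL2) in pL sL *.
rewrite (siso_proper Hs) // in pL; rewrite (siso_mono Hs) // in sL.
by congr (gval (s _)); apply/val_inj/maxK.
Qed.

Lemma siso_maximal (gT1 gT2 : finGroupType) (G1 : {group gT1})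
    (G2 : {group gT2}) s t (H K : {group gT1}) : subgroup_iso G1 G2 s t ->
  H \subset G1 -> K \subset G1 -> maximal (s K) (s H) = maximal K H.
Proof.
move=> Hs sH sK; apply/idP/idP; last exact: siso_maximal_imp Hs sH sK.
move/(siso_maximal_imp (subgroup_iso_sym Hs) (siso_sub Hs sH) (siso_sub Hs sK)).
by rewrite !(sisoK Hs).
Qed.

Section Assembly.

Variables (gT1 gT2 : finGroupType) (G1 : {group gT1}) (G2 : {group gT2}).
Variables (s : {group gT1} -> {group gT2}) (t : {group gT2} -> {group gT1}).

Definition subgroup_map (Hs : subgroup_iso G1 G2 s t) (K : subgroup_of G1) :
  subgroup_of G2 := Subgroup (siso_sub Hs (valP K)).

Lemma subgroup_map_inj (Hs : subgroup_iso G1 G2 s t) : injective (subgroup_map Hs).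
Proof.
move=> H K /(congr1 val) e; apply/val_inj; move: e.
exact: (siso_inj Hs (valP H) (valP K)).
Qed.

(** A division [d] goes to the one containing a generator of [s <[repr (val d)]>]; the matching is
    then translated so that the representative of the new division generates the acting group. *)
Lemma division_map_exists (Ds : division_iso G1 G2 s t) :
  exists delta : {d | d \in divisions G1} -> {d | d \in divisions G2},
  injective delta /\ forall d, exists p,
    splitting_iso G1 G2 s <[repr (val d)]> <[repr (val (delta d))]> p.
Proof.
have Hs : subgroup_iso G1 G2 s t := Ds.
(* The second clause serves injectivity: if two divisions have the same image, [s] makes their
   cyclic groups conjugate, and the inverse isomorphism pulls the conjugacy back. *)
pose P (d : {d | d \in divisions G1}) (e : {d | d \in divisions G2}) :=
  (exists p, splitting_iso G1 G2 s <[repr (val d)]> <[repr (val e)]> p) /\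
  (exists2 y, y \in G2 & s <[repr (val d)]>%G :=: <[repr (val e)]> :^ y).
have [d|delta deltaP] := @fin_all_exists _ _ P; last first.
  exists delta; split=> [d1 d2 e12|d]; last by case: (deltaP d).
  have [_ [y1 Gy1 e1]] := deltaP d1; have [_ [y2 Gy2 e2]] := deltaP d2.
  have sC (d : {d | d \in divisions G1}) : <[repr (val d)]>%G \subset G1.
    by rewrite cycle_subG division_repr_in.
  have sC1 := sC d1; have sC2 := sC d2.
  have cS (d : {d | d \in divisions G1}) : cyclic (s <[repr (val d)]>%G).
    by apply: (div_cyclic Ds); [apply: sC | apply: cycle_cyclic].
  have [|x Gx] := div_conj_imp (division_iso_sym Ds) (siso_sub Hs sC1)
    (siso_sub Hs sC2) (cS d1).
    exists (y1^-1 * y2); first by rewrite groupM ?groupV.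
    by rewrite e1 e2 e12 conjsgM conjsgK.
  by rewrite !(sisoK Hs) // => e; apply: division_eq_conj; exists x.
set x := repr (val d).
have sC : <[x]>%G \subset G1 by rewrite cycle_subG division_repr_in.
have [p Hp _] := div_split Ds sC (cycle_cyclic x).
have /cyclicP[y ey] := div_cyclic Ds sC (cycle_cyclic x).
have Gy : y \in G2 by rewrite -cycle_subG -ey (siso_sub Hs).
have [e dy] := division_exists Gy; exists e.
have [_ [g Gg eg]] := division_mem e y dy.
split; last by exists g; rewrite ?ey.
have := splJr (groupVr Gg) Hp; rewrite ey eg conjsgK => Hp'.
by eexists; apply: Hp'.
Qed.

Lemma division_iso_inj (Ds : division_iso G1 G2 s t) :
  exists f : division_graph G1 -> division_graph G2,
  [/\ injective f, forall v, colour (f v) = subgroup_map Ds (colour v)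
    & forall u v, arc (f u) (f v) = arc u v].
Proof.
have Hs : subgroup_iso G1 G2 s t := Ds; set sG := subgroup_map Ds.
have [delta [dinj /fin_all_exists[p Hp]]] := division_map_exists Ds.
pose P v w := [/\ vdiv w = delta (vdiv v), vsub w = sG (vsub v)
                & vset w = p (vdiv v) (vsub v) (vset v)].
have [v|f fP] := @fin_all_exists _ _ P.
  apply: vertex_exists; apply: (spl_in (Hp _)); [exact: vsub_sub|exact: vset_in].
exists f; split.
- move=> u v e; have [e1 e2 e3] := fP u; have [e1' e2' e3'] := fP v.
  have ed : vdiv u = vdiv v by apply: dinj; rewrite -e1 -e1' e.
  have es : vsub u = vsub v.
    by apply: (@subgroup_map_inj Ds); rewrite -/sG -e2 -e2' e.
  apply: vertex_inj => //; apply: (spl_inj (Hp (vdiv u)) (vsub_sub u)).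
  + exact: vset_in.
  + by rewrite ed es vset_in.
  + by rewrite -e3 e ed es.
- by move=> v; have [_ e _] := fP v.
move=> u v; rewrite !division_arcE.
have [e1 e2 e3] := fP u; have [e1' e2' e3'] := fP v.
rewrite e1 e1' e2 e2' e3 e3' inj_eq // (siso_maximal Hs) ?vsub_sub //.
have [ed|] //= := eqVneq; have [maxH|] //= := boolP (maximal _ _).
have sK : vsub v \subset vsub u by have /maxgroupp/proper_sub := maxH.
have vI := vset_in v; rewrite -ed in vI *.
rewrite (spl_mono (Hp _)) ?vset_in ?vsub_sub //.
by rewrite !(spl_card (Hp _)) ?vset_in ?vsub_sub // !(siso_card Hs) ?vsub_sub.
Qed.

End Assembly.

(** Injections in both directions between finite types are bijective, so surjectivity on vertices
    and on colours comes from counting. *)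
Lemma division_iso_graph (gT1 gT2 : finGroupType) (G1 : {group gT1})
    (G2 : {group gT2}) s t (Ds : division_iso G1 G2 s t) :
  exists f : division_graph G1 -> division_graph G2,
    cgraph_iso (subgroup_map Ds) f.
Proof.
have [f [finj fcol farc]] := division_iso_inj Ds.
have [g [ginj _ _]] := division_iso_inj (division_iso_sym Ds).
exists f; split=> //; last by apply: inj_card_bij => //; apply: leq_card ginj.
apply: inj_card_bij (@subgroup_map_inj _ _ _ _ _ _ Ds) _.
exact: leq_card (@subgroup_map_inj _ _ _ _ _ _ (division_iso_sym Ds)).
Qed.

(** * Graph isomorphisms induce division isomorphisms *)

(** Orbit-stabilizer for [C] acting on the right cosets of [H]: the stabilizer of [H :* x] is
    [H :^ x :&: C]. *)
Lemma dcoset_card_stab (gT : finGroupType) (H C : {group gT}) x :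
  (#|(H :* x * C)%g| %/ #|H| * #|(H :^ x :&: C)%g|)%N = #|C|.
Proof.
have e : #|H :* x * C| = #|H :^ x * C|.
  rewrite -[LHS](card_lcoset _ x^-1); congr #|(_ : {set gT})|.
  by rewrite conjsgE !mulgA.
apply/eqP; rewrite -(eqn_pmul2r (cardG_gt0 H)) e.
have dv : (#|(H :^ x * C)%g| %/ #|H| * #|H|)%N = #|H :^ x * C|.
  rewrite -e; apply: (@dcosets_card_dvd _ [set: gT]%G H C).
  by apply: mem_dcosets; rewrite inE.
by rewrite mulnAC dv -mul_cardG cardJg mulnC.
Qed.

(** Going down from [H] to [K] shrinks the stabilizer, so orbit sizes grow by an integer factor.
    Hence the truncated division in arc labels is exact. *)
Lemma dcosets_size_dvd (gT : finGroupType) (G H K C : {group gT}) A B :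
    K \subset H -> A \in dcosets G H C -> B \in dcosets G K C -> B \subset A ->
  #|A| %/ #|H| %| #|B| %/ #|K|.
Proof.
move=> sKH AA BB sBA; have [x Bx] := dcosets_neq0 BB.
have eH := dcoset_card_stab H C x; have eK := dcoset_card_stab K C x.
rewrite (dcosets_eq AA (subsetP sBA x Bx)) (dcosets_eq BB Bx).
have dI : #|K :^ x :&: C| %| #|H :^ x :&: C| by rewrite cardSg // setSI // conjSg.
rewrite -(dvdn_pmul2r (cardG_gt0 (K :^ x :&: C)%G)) /= eK -eH.
exact: dvdn_mul.
Qed.

Lemma maximal_above (gT : finGroupType) (G K : {group gT}) : K \proper G ->
  exists H : subgroup_of G, maximal K H.
Proof.
move=> pK; pose P (L : {group gT}) := (K \proper L) && (L \subset G).
have [|M /mingroupP[/andP[pKM sMG] minM] _] := @mingroup_exists _ P G.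
  by rewrite /P pK /=.
exists (Subgroup sMG); apply/maxgroupP; split=> //= L pL sKL.
apply/eqP; rewrite eqEsubset sKL andbT; apply: contraLR pL => nsLK.
have e : L :=: M -> ~~ (L \proper M) by move->; rewrite properE subxx.
apply/negP=> pL; have sLM := proper_sub pL.
suff /e/negP: L :=: M by [].
apply: minM => //; rewrite /P properE sKL nsLK /=.
exact: subset_trans sLM sMG.
Qed.

Section DivisionGraphFacts.

Variables (gT : finGroupType) (G : {group gT}).
Local Notation divT := {d : {set gT} | d \in divisions G}.
Implicit Types (d : divT) (u v : division_graph G).

Definition vsize v := #|vset v| %/ #|vsub v|.

Lemma vset_card v : #|vset v| = (vsize v * #|vsub v|)%N.
Proof. by rewrite /vsize (dcosets_card_dvd (vset_in v)). Qed.

Lemma division_nonempty : exists d, True.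
Proof. by have [d _] := division_exists (group1 G); exists d. Qed.

Lemma vdiv_onto d : exists v, vdiv v = d.
Proof.
have [v [v1 _ _]] :=
  vertex_exists (mem_dcosets (subgroupT G) <[repr (val d)]> (group1 G)).
by exists v.
Qed.

(** Combined with [vertex_inj], this leaves a single vertex of colour [G] in each component, which
    can stand for its division. *)
Lemma vset_top v : vsub v = subgroupT G -> vset v = G.
Proof.
move=> e; have := vset_in v; rewrite e /= => vI.
have sC : <[repr (val (vdiv v))]> \subset G by rewrite cycle_subG division_repr_in.
have [x vx] := dcosets_neq0 vI.
have Gx := subsetP (dcosets_sub (subxx G) sC vI) x vx.
by rewrite (dcosets_eq vI vx) rcoset_id // mulGSid.
Qed.

Lemma vertex_over v (H : subgroup_of G) : vsub v \subset H ->
  exists u, [/\ vdiv u = vdiv v, vsub u = H & vset v \subset vset u].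
Proof.
move=> sK; have [A AA sBA] := dcosets_up sK (vset_in v).
by have [u [e1 e2 e3]] := vertex_exists AA; exists u; split=> //; rewrite e3.
Qed.

Lemma sum_vset d (H : subgroup_of G) :
  \sum_(v | (vdiv v == d) && (vsub v == H)) #|vset v| = #|G|.
Proof.
have sC : <[repr (val d)]> \subset G by rewrite cycle_subG division_repr_in.
rewrite -(sum_card_dcosets (valP H) sC).
have -> : dcosets G (val H) <[repr (val d)]> =
    (@vset _ G) @: [set v | (vdiv v == d) && (vsub v == H)].
  apply/setP=> A; apply/idP/imsetP=> [/vertex_exists[v [e1 e2 <-]]|[v]].
    by exists v; rewrite // inE e1 e2 !eqxx.
  by rewrite inE => /andP[/eqP<- /eqP<-] ->; apply: vset_in.
rewrite big_imset /=; first by apply: eq_bigl => v; rewrite inE.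
move=> u v; rewrite !inE => /andP[/eqP e1 /eqP e2] /andP[/eqP e1' /eqP e2'] e.
by apply: vertex_inj; rewrite ?e1 ?e2.
Qed.

Lemma sum_vsize d (H : subgroup_of G) :
  (\sum_(v | (vdiv v == d) && (vsub v == H)) vsize v * #|H|)%N = #|G|.
Proof.
rewrite -[RHS](sum_vset d H); apply: eq_bigr => v /andP[_ /eqP<-].
by rewrite vset_card.
Qed.

End DivisionGraphFacts.

(** * Inclusions, orbit sizes and components under a graph isomorphism *)

Record graph_iso (gT1 gT2 : finGroupType) (G1 : {group gT1}) (G2 : {group gT2})
    (s : subgroup_of G1 -> subgroup_of G2) (s' : subgroup_of G2 -> subgroup_of G1)
    (f : division_graph G1 -> division_graph G2)
    (f' : division_graph G2 -> division_graph G1) : Prop := GraphIso {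
  gisoK : cancel s s'; gisoKV : cancel s' s;
  giso_fK : cancel f f'; giso_fKV : cancel f' f;
  giso_sub : forall v, vsub (f v) = s (vsub v);
  giso_arc : forall u v, arc (f u) (f v) = arc u v
}.

(** Each implication proved for a graph isomorphism also applies to its inverse, so the equivalences
    below need one direction only. *)
Lemma graph_iso_sym (gT1 gT2 : finGroupType) (G1 : {group gT1}) (G2 : {group gT2})
    (s : subgroup_of G1 -> subgroup_of G2) s'
    (f : division_graph G1 -> division_graph G2) f' :
  graph_iso s s' f f' -> graph_iso s' s f' f.
Proof.
case=> sK s'K fK f'K col arcs; split=> // [v|u v].
  by rewrite -{2}(f'K v) col sK.
by rewrite -{2}(f'K u) -{2}(f'K v) arcs.
Qed.

Section GraphIsoImp.

Variables (gT1 gT2 : finGroupType) (G1 : {group gT1}) (G2 : {group gT2}).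
Variable s : subgroup_of G1 -> subgroup_of G2.
Variable s' : subgroup_of G2 -> subgroup_of G1.
Variables (f : division_graph G1 -> division_graph G2).
Variable (f' : division_graph G2 -> division_graph G1).
Hypothesis Hf : graph_iso s s' f f'.
Implicit Types (H K : subgroup_of G1) (u v : division_graph G1).

(** Any component serves: it contains an arc from a vertex of colour [H] to one of colour [K], and
    its image is an arc. *)
Lemma giso_maximal H K : maximal K H -> maximal (s K) (s H).
Proof.
move=> maxK; have sKH : K \subset H by have /maxgroupp/proper_sub := maxK.
have [d _] := division_nonempty G1.
have [v [v1 v2 v3]] := vertex_exists (mem_dcosets K <[repr (val d)]> (group1 G1)).
have [|u [u1 u2 u3]] := @vertex_over _ _ v H; first by rewrite v2.
have := giso_arc Hf u v; rewrite !division_arcE u1 u2 v2 u3 maxK eqxx /=.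
by rewrite !(giso_sub Hf) u2 v2; case: ifP => // /and3P[].
Qed.

Lemma giso_subset H K : K \subset H -> s K \subset s H.
Proof.
have [n] := ubnP #|H|; elim: n H => // n IHn H /ltnSE leHn sKH.
have [e|[M maxM sKM]] := maximal_exists sKH.
  by rewrite (_ : K = H) //; apply/val_inj/val_inj.
have pM : M \proper H by case/maxgroupP: maxM.
have sM := subset_trans (proper_sub pM) (valP H).
have := @giso_maximal H (Subgroup sM) maxM => /maxgroupp/proper_sub.
apply: subset_trans; apply: IHn => //=.
by apply: leq_trans leHn; apply: proper_card.
Qed.

Lemma giso_arc_facts u v : vdiv u = vdiv v -> maximal (vsub v) (vsub u) ->
    vset v \subset vset u ->
  [/\ vdiv (f u) = vdiv (f v), vset (f v) \subset vset (f u)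
    & vsize (f v) %/ vsize (f u) = vsize v %/ vsize u].
Proof.
move=> e maxK sS; have := giso_arc Hf u v; rewrite !division_arcE e eqxx maxK sS /=.
by case: ifP => // /and3P[/eqP -> _ ->] [] ->.
Qed.

(** Induction down a maximal chain from [vsub u] to [vsub v]: the double coset of the intermediate
    group over [v] meets [vset u], so it lies inside. The inclusion is thus an arc followed by a
    smaller case. *)
Lemma giso_vset u v : vdiv u = vdiv v -> vsub v \subset vsub u ->
  vset v \subset vset u -> vset (f v) \subset vset (f u).
Proof.
have [n] := ubnP #|vsub u|; elim: n u => // n IHn u /ltnSE leHn e sKH sBA.
have [eKH|[M maxM sKM]] := maximal_exists sKH.
  have es : vsub v = vsub u by apply/val_inj/val_inj.
  suff -> : u = v by [].
  apply: vertex_inj => //; apply/esym/(dcosets_inj (vset_in v)) => //.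
  by have := vset_in u; rewrite e es.
have pM : M \proper vsub u by case/maxgroupP: maxM.
have sM := subset_trans (proper_sub pM) (vsub_sub u).
have [|w [w1 w2 w3]] := @vertex_over _ _ v (Subgroup sM); first by [].
have [x vx] := dcosets_neq0 (vset_in v).
have ww : vset w \subset vset u.
  have wI := vset_in w; rewrite w1 -e in wI.
  apply/(dcosets_subP _ (vset_in u) wI); first by rewrite w2 /= proper_sub.
  by exists x; [apply: (subsetP w3) | apply: (subsetP sBA)].
have [||//|_ sw _] := @giso_arc_facts u w; rewrite ?w1 ?w2 //.
apply: subset_trans sw; apply: IHn; rewrite ?w2 //=.
by apply: leq_trans leHn; apply: proper_card.
Qed.

End GraphIsoImp.

Section GraphIso.

Variables (gT1 gT2 : finGroupType) (G1 : {group gT1}) (G2 : {group gT2}).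
Variable s : subgroup_of G1 -> subgroup_of G2.
Variable s' : subgroup_of G2 -> subgroup_of G1.
Variables (f : division_graph G1 -> division_graph G2).
Variable (f' : division_graph G2 -> division_graph G1).
Hypothesis Hf : graph_iso s s' f f'.
Implicit Types (H K : subgroup_of G1) (u v : division_graph G1).

Lemma giso_mono H K : (s H \subset s K) = (H \subset K).
Proof.
apply/idP/idP; last exact: (giso_subset Hf).
by move/(giso_subset (graph_iso_sym Hf)); rewrite !(gisoK Hf).
Qed.

Lemma giso_top : s (subgroupT G1) = subgroupT G2.
Proof.
apply/val_inj/val_inj/eqP; rewrite eqEsubset /= (valP (s _)) /=.
have := giso_mono (s' (subgroupT G2)) (subgroupT G1).
by rewrite (gisoKV Hf) /= => ->; apply: (valP (s' _)).
Qed.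

(** Climb from [v] along arcs to the vertex of colour [G1]: arcs keep the images in one component,
    and the orbit size of [v] is the product of the labels met, the size at the top being 1. *)
Lemma giso_above v : exists w, [/\ vdiv w = vdiv v, vsub w = subgroupT G1,
  vdiv (f w) = vdiv (f v) & vsize (f v) = vsize v].
Proof.
have [n] := ubnP (#|G1| - #|vsub v|); elim: n v => // n IHn v /ltnSE le_n.
have [e|ne] := eqVneq (vsub v) (subgroupT G1).
  exists v; split=> //; rewrite /vsize !vset_top ?(giso_sub Hf) ?e ?giso_top //=.
  by rewrite !divnn !cardG_gt0.
have pv : vsub v \proper G1.
  rewrite properEneq vsub_sub andbT; apply: contraNneq ne => e.
  exact/eqP/val_inj/val_inj.
have [H maxH] := maximal_above pv.
have pH : vsub v \proper H by case/maxgroupP: maxH.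
have [u [u1 u2 u3]] := vertex_over (proper_sub pH).
have [|w [w1 w2 w3 w4]] := IHn u.
  apply: leq_trans le_n; rewrite u2 ltn_sub2l ?proper_card //.
exists w; rewrite w1 w2 w3 u1.
have [||e1 _ e3] := giso_arc_facts Hf u1; rewrite ?u2 //; split=> //.
(* Divisibility makes the labels exact ratios, so equal labels and equal sizes at [u] give equal
   sizes at [v]. *)
have dv : vsize u %| vsize v.
  rewrite /vsize; apply: (@dcosets_size_dvd _ G1 _ _ <[repr (val (vdiv v))]>) => //.
  - by rewrite u2 proper_sub.
  - by rewrite -u1 vset_in.
  - exact: vset_in.
have dfv : vsize (f u) %| vsize (f v).
  rewrite /vsize; apply: (@dcosets_size_dvd _ G2 _ _ <[repr (val (vdiv (f v)))]>).
  - by rewrite !(giso_sub Hf) giso_mono u2 proper_sub.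
  - by rewrite -e1 vset_in.
  - exact: vset_in.
  - by rewrite (giso_vset Hf) // u2 proper_sub.
by rewrite -(divnK dv) -(divnK dfv) e3 w4.
Qed.

Lemma giso_vsize v : vsize (f v) = vsize v.
Proof. by have [w []] := giso_above v. Qed.

(** Both vertices lie below the same vertex of colour [G1], and each stays in one component with it
    under [f]. *)
Lemma giso_vdiv_imp u v : vdiv u = vdiv v -> vdiv (f u) = vdiv (f v).
Proof.
move=> e; have [w [w1 w2 <- _]] := giso_above u.
have [z [z1 z2 <- _]] := giso_above v.
by congr (vdiv (f _)); apply: vertex_inj; rewrite ?w1 ?z1 ?w2 ?z2 // !vset_top.
Qed.

End GraphIso.

(** * Orders of subgroups and the bijection of divisions *)

Section GraphIsoDivision.

Variables (gT1 gT2 : finGroupType) (G1 : {group gT1}) (G2 : {group gT2}).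
Variable s : subgroup_of G1 -> subgroup_of G2.
Variable s' : subgroup_of G2 -> subgroup_of G1.
Variables (f : division_graph G1 -> division_graph G2).
Variable (f' : division_graph G2 -> division_graph G1).
Hypothesis Hf : graph_iso s s' f f'.
Implicit Types (H K : subgroup_of G1) (u v : division_graph G1).

Lemma giso_vdiv u v : (vdiv (f u) == vdiv (f v)) = (vdiv u == vdiv v).
Proof.
apply/eqP/eqP; last exact: (giso_vdiv_imp Hf).
by move/(giso_vdiv_imp (graph_iso_sym Hf)); rewrite !(giso_fK Hf).
Qed.

(** Within a component, the orbits of colour [H] have total size the index of [H], and [f] carries
    them to the orbits of colour [s H]. The equality of indices is cross-multiplied because the
    orders of [G1] and [G2] are not yet compared. *)
Lemma giso_index H : (#|G1| * #|s H| = #|G2| * #|H|)%N.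
Proof.
have [d _] := division_nonempty G1.
have [w w1] := vdiv_onto d.
rewrite -(sum_vsize d H) -(sum_vsize (vdiv (f w)) (s H)) -!big_distrl /=.
rewrite mulnAC; congr (_ * _ * _)%N.
rewrite [RHS](reindex f) /=; last first.
  by exists f' => x _; [apply: (giso_fK Hf) | apply: (giso_fKV Hf)].
apply: eq_big => [v|v _]; last by rewrite (giso_vsize Hf).
by rewrite giso_vdiv w1 (giso_sub Hf) (can_eq (gisoK Hf)).
Qed.

(** At the trivial subgroup, equality of indices becomes equality of the orders of [G1] and [G2]. *)
Lemma giso_card H : #|s H| = #|H|.
Proof.
pose H1 := Subgroup (sub1G G1).
have s1 : s H1 :=: 1.
  apply/trivgP; have := giso_mono Hf H1 (s' (Subgroup (sub1G G2))).
  by rewrite (gisoKV Hf) /= sub1G.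
have c1 : #|H1| = 1%N by apply: cards1.
have eG : #|G1| = #|G2| by have := giso_index H1; rewrite s1 cards1 c1 !muln1.
by apply/eqP; rewrite -(eqn_pmul2l (cardG_gt0 G1)) giso_index eG.
Qed.

Lemma giso_division_map :
  exists delta : {d | d \in divisions G1} -> {d | d \in divisions G2},
  injective delta /\ forall v, vdiv (f v) = delta (vdiv v).
Proof.
pose P (d : {d | d \in divisions G1}) (e : {d | d \in divisions G2}) :=
  forall v, (vdiv (f v) == e) = (vdiv v == d).
have [d|delta dP] := @fin_all_exists _ _ P.
  have [w w1] := vdiv_onto d.
  by exists (vdiv (f w)) => v; rewrite giso_vdiv w1.
exists delta; split=> [d1 d2 e|v]; last by apply/eqP; rewrite dP.
have [w w1] := vdiv_onto d1.
by rewrite -w1; apply/eqP; rewrite -dP -e dP w1.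
Qed.

(** Total extension of [s], as [subgroup_iso] requires; [1%G] arises only for groups not contained
    in [G1]. *)
Definition group_map (H : {group gT1}) : {group gT2} :=
  if insub H is Some H' then sgval (s H') else 1%G.

Lemma group_mapE H : group_map H = s H.
Proof. by rewrite /group_map valK. Qed.

End GraphIsoDivision.

(** * Recovering the splitting isomorphisms from the graph *)

Section GraphIsoSplitting.

Variables (gT1 gT2 : finGroupType) (G1 : {group gT1}) (G2 : {group gT2}).
Variable s : subgroup_of G1 -> subgroup_of G2.
Variable s' : subgroup_of G2 -> subgroup_of G1.
Variables (f : division_graph G1 -> division_graph G2).
Variable (f' : division_graph G2 -> division_graph G1).
Hypothesis Hf : graph_iso s s' f f'.

Lemma giso_siso : subgroup_iso G1 G2 (group_map s) (group_map s').
Proof.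
have lift1 (H : {group gT1}) : H \subset G1 -> exists H' : subgroup_of G1, H = H'.
  by move=> sH; exists (Subgroup sH).
have lift2 (H : {group gT2}) : H \subset G2 -> exists H' : subgroup_of G2, H = H'.
  by move=> sH; exists (Subgroup sH).
split=> [H|H|H|H|H K|H].
- by case/lift1=> {}H ->; rewrite group_mapE (valP (s H)).
- by case/lift2=> {}H ->; rewrite group_mapE (valP (s' H)).
- by case/lift1=> {}H ->; rewrite !group_mapE (gisoK Hf).
- by case/lift2=> {}H ->; rewrite !group_mapE (gisoKV Hf).
- by case/lift1=> {}H -> /lift1[{}K ->]; rewrite !group_mapE (giso_mono Hf).
- by case/lift1=> {}H ->; rewrite group_mapE (giso_card Hf).
Qed.

Variable delta : {d | d \in divisions G1} -> {d | d \in divisions G2}.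
Hypothesis delta_inj : injective delta.
Hypothesis delta_vdiv : forall v, vdiv (f v) = delta (vdiv v).

Lemma giso_splitting d : exists p,
  splitting_iso G1 G2 (group_map s) <[repr (val d)]> <[repr (val (delta d))]> p.
Proof.
pose P (H : {group gT1}) A v := [&& vdiv v == d, val (vsub v) == H & vset v == A].
(* [vertex_inj] makes the picked vertex unique; [set0] is returned only when no vertex has this
   triple. *)
pose p H A := if [pick v | P H A v] is Some v then vset (f v) else set0.
have pE v : vdiv v = d -> p (val (vsub v)) (vset v) = vset (f v).
  move=> ev; rewrite /p; case: pickP => [w /and3P[/eqP w1 /eqP w2 /eqP w3] | /(_ v)].
    by congr (vset (f _)); apply: vertex_inj; rewrite ?w1 //; apply/val_inj.
  by rewrite /P ev !eqxx.
have vE (H : {group gT1}) A : H \subset G1 -> A \in dcosets G1 H <[repr (val d)]> ->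
    exists v, [/\ vdiv v = d, H = val (vsub v) & A = vset v].
  move=> sH AA; have [v [v1 v2 v3]] := @vertex_exists _ _ d (Subgroup sH) A AA.
  by exists v; rewrite v2.
exists p; split=> [H A sH|H B sH|H A sH|H K A B sH sK].
- case/vE=> // v [ev -> ->]; rewrite pE // group_mapE -(giso_sub Hf) -ev -delta_vdiv.
  exact: vset_in.
- have eH : H = val (Subgroup sH) by []; rewrite {1}eH group_mapE.
  case/vertex_exists=> w [w1 w2 w3]; rewrite -(giso_fKV Hf w) in w1 w2 w3.
  set v := f' w in w1 w2 w3.
  (* Injectivity of [delta] forces the preimage of [w] into the component of [d]. *)
  have ev : vdiv v = d by apply: delta_inj; rewrite -delta_vdiv.
  have es : vsub v = Subgroup sH.
    by apply: (can_inj (gisoK Hf)); rewrite -(giso_sub Hf).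
  by exists (vset v); [have := vset_in v; rewrite es ev | rewrite eH -es pE].
- case/vE=> // v [ev eH ->]; rewrite eH pE // !vset_card (giso_vsize Hf).
  by rewrite (giso_sub Hf) (giso_card Hf).
case/vE=> // u [eu eH ->] /vE[|v [ev eK ->]]; first exact: subset_trans sH.
rewrite eH eK !pE // -[vset v in RHS]/(vset v).
have sK' : vsub v \subset vsub u by rewrite eH eK in sK.
apply/idP/idP=> [sf|]; last by apply: (giso_vset Hf); rewrite ?eu.
rewrite -(giso_fK Hf u) -(giso_fK Hf v).
apply: (giso_vset (graph_iso_sym Hf)) sf; first by rewrite !delta_vdiv eu ev.
by rewrite !(giso_sub Hf) (giso_mono Hf).
Qed.

Lemma giso_delta_conj d : exists2 y, y \in G2 &
  group_map s <[repr (val d)]>%G :=: <[repr (val (delta d))]> :^ y.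
Proof.
have [p Hp] := giso_splitting d.
by apply: (spl_conj giso_siso Hp); rewrite cycle_subG division_repr_in.
Qed.

(** A cyclic [C] is conjugate to the group of the representative of its division, so [splJl] moves
    the matching of that division to [C], and [spl_point] adjusts the base point. *)
Lemma giso_pointed (C : {group gT1}) : C \subset G1 -> cyclic C ->
  cyclic (group_map s C) /\
  exists2 p, splitting_iso G1 G2 (group_map s) C (group_map s C) p
           & p C C = group_map s C.
Proof.
move=> sC /cyclicP[x eC].
have Gx : x \in G1 by rewrite -cycle_subG -eC.
have [d dx] := division_exists Gx; have [_ [g Gg eg]] := division_mem d x dx.
have [p Hp] := giso_splitting d.
have := splJl Gg Hp; rewrite -eg -eC => Hp'.
have sD : <[repr (val (delta d))]>%G \subset G2.
  by rewrite cycle_subG division_repr_in.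
split; last exact: (spl_point giso_siso Hp' sC sD).
have [y _ ->] := spl_conj giso_siso Hp' sC sD.
by rewrite cyclicJ cycle_cyclic.
Qed.

End GraphIsoSplitting.

(** The bijection [delta] is exported too, since the claims on divisions refer to the components
    that [f] itself matches. *)
Lemma cgraph_iso_division_iso (gT1 gT2 : finGroupType) (G1 : {group gT1})
    (G2 : {group gT2}) (s : subgroup_of G1 -> subgroup_of G2)
    (f : division_graph G1 -> division_graph G2) : cgraph_iso s f ->
  exists S T, [/\ division_iso G1 G2 S T, forall H : subgroup_of G1, S H = s H
    & exists delta : {d | d \in divisions G1} -> {d | d \in divisions G2},
      [/\ bijective delta, forall v, vdiv (f v) = delta (vdiv v)
        & forall d, exists2 y, y \in G2 &
            S <[repr (val d)]>%G :=: <[repr (val (delta d))]> :^ y]].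
Proof.
case=> [[s' sK s'K] [f' fK f'K] col arcs].
have Hf : graph_iso s s' f f' by split.
have Hf' := graph_iso_sym Hf.
have [delta [dinj dE]] := giso_division_map Hf.
have [delta' [dinj' dE']] := giso_division_map Hf'.
exists (group_map s), (group_map s'); split; last 1 first.
- exists delta; split=> //; last exact: (giso_delta_conj Hf dinj dE).
  by apply: inj_card_bij => //; apply: leq_card dinj'.
- split=> [|C sC cC|C sC cC|C sC cC]; first exact: giso_siso Hf.
  + by have [] := giso_pointed Hf dinj dE sC cC.
  + by have [] := giso_pointed Hf' dinj' dE' sC cC.
  + by have [] := giso_pointed Hf dinj dE sC cC.
- exact: group_mapE.
Qed.

(** * Properties preserved by division isomorphisms *)

Section SubgroupIsoMore.

Variables (gT1 gT2 : finGroupType) (G1 : {group gT1}) (G2 : {group gT2}).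
Variables (s : {group gT1} -> {group gT2}) (t : {group gT2} -> {group gT1}).
Hypothesis Hs : subgroup_iso G1 G2 s t.

(** Lets an equality such as that of normalizers or centralizers follow from one inclusion, applied
    to [s] and to [t]. *)
Lemma siso_group_eq (X1 : {group gT1}) (X2 : {group gT2}) :
    X1 \subset G1 -> X2 \subset G2 -> s X1 \subset X2 -> t X2 \subset X1 ->
  s X1 = X2.
Proof.
move=> sX1 sX2 s12 s21; apply/val_inj/eqP; rewrite eqEsubset s12 /=.
by rewrite -{1}(sisoKV Hs sX2) (siso_mono Hs) // (siso_subV Hs).
Qed.

Lemma siso_trivg (H : {group gT1}) : H \subset G1 -> (s H :==: 1) = (H :==: 1).
Proof. by move=> sH; rewrite !trivg_card1 (siso_card Hs). Qed.

End SubgroupIsoMore.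

Section Consequences.

Variables (gT1 gT2 : finGroupType) (G1 : {group gT1}) (G2 : {group gT2}).
Variables (s : {group gT1} -> {group gT2}) (t : {group gT2} -> {group gT1}).
Hypothesis Ds : division_iso G1 G2 s t.
Let Hs : subgroup_iso G1 G2 s t := Ds.
Let Ds' := division_iso_sym Ds.
Implicit Types H K L C : {group gT1}.

Lemma div_normal_full H : H \subset G1 -> (s H <| G2) = (H <| G1).
Proof.
move=> sH; apply/idP/idP; last exact: (div_normal_imp Ds).
by move/(div_normal_imp Ds' (siso_sub Hs sH)); rewrite (sisoK Hs).
Qed.

Lemma div_cyclicE H : H \subset G1 -> cyclic (s H) = cyclic H.
Proof.
move=> sH; apply/idP/idP; last exact: (div_cyclic Ds).
by move/(div_cyclicV Ds (siso_sub Hs sH)); rewrite (sisoK Hs).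
Qed.

Lemma div_conj H K : H \subset G1 -> K \subset G1 -> cyclic H ->
  (exists2 x, x \in G1 & K :=: H :^ x) <->
  (exists2 y, y \in G2 & s K :=: s H :^ y).
Proof.
move=> sH sK cH; split; first exact: (div_conj_imp Ds).
have cS : cyclic (s H) by rewrite div_cyclicE.
move/(div_conj_imp Ds' (siso_sub Hs sH) (siso_sub Hs sK) cS).
by rewrite !(sisoK Hs).
Qed.

End Consequences.

(** * Direct products and abelian groups *)

Lemma div_normal (gT1 gT2 : finGroupType) (G1 : {group gT1}) (G2 : {group gT2})
    s t (H K : {group gT1}) : division_iso G1 G2 s t ->
  K \subset H -> H \subset G1 -> (s K <| s H) = (K <| H).
Proof. by move=> Ds sKH sH; rewrite (div_normal_full (div_restrict Ds sH)). Qed.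

(** An internal direct product consists of two normal subgroups with trivial meet and full join, all
    of which is preserved; the factors commute because their commutators lie in both. *)
Lemma div_dprod_imp (gT1 gT2 : finGroupType) (G1 : {group gT1})
    (G2 : {group gT2}) s t (H K L : {group gT1}) : division_iso G1 G2 s t ->
  L \subset G1 -> H \x K = L -> s H \x s K = s L.
Proof.
move=> Ds sL defL; have Hs : subgroup_iso G1 G2 s t := Ds.
have [nsH nsK] := dprod_normal2 defL; have [_ _ cHK tiHK] := dprodP defL.
have [sHL sKL] := (normal_sub nsH, normal_sub nsK).
have [sH sK] := (subset_trans sHL sL, subset_trans sKL sL).
have tiS : s H :&: s K = 1.
  rewrite -[LHS]/(gval (s H :&: s K)%G) -(sisoI Hs) //.
  by rewrite (_ : H :&: K = 1)%G ?(siso1 Hs) //; apply/val_inj.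
have eY : (H <*> K)%G = L by apply/val_inj; rewrite /= -(dprodEY cHK tiHK).
have eYS : s H <*> s K = s L by rewrite -eY (sisoY Hs).
have nH : s H <| s L by rewrite (div_normal Ds).
have nK : s K <| s L by rewrite (div_normal Ds).
have nKH := subset_trans (normal_sub nK) (normal_norm nH).
have nHK := subset_trans (normal_sub nH) (normal_norm nK).
rewrite dprodEY // centsC; apply/commG1P/trivgP.
by rewrite -tiS subsetI commg_subl commg_subr nKH.
Qed.

Lemma div_bigdprod_imp (gT1 gT2 : finGroupType) (G1 : {group gT1})
    (G2 : {group gT2}) s t (r : seq {group gT1}) (L : {group gT1}) :
    division_iso G1 G2 s t -> L \subset G1 ->
    \big[dprod/1]_(H <- r) (H : {set gT1}) = L ->
  \big[dprod/1]_(H <- r) (s H : {set gT2}) = s L.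
Proof.
move=> Ds; elim: r L => [|H r IHr] L sL.
  rewrite !big_nil => e; rewrite (_ : L = 1%G) ?(siso1 Ds) //.
  exact/val_inj.
rewrite !big_cons => defL; have [[_ K _ eK] eL _ _] := dprodP defL.
rewrite eK in defL eL.
have sK : K \subset G1 by rewrite (subset_trans _ sL) // -eL mulG_subr.
by rewrite (IHr K sK eK) (div_dprod_imp Ds sL).
Qed.

(** The decomposition into cyclic factors is carried factor by factor, and cyclic groups of equal
    order are isomorphic. *)
Lemma div_abelian_isog (gT1 gT2 : finGroupType) (G1 : {group gT1})
    (G2 : {group gT2}) s t : division_iso G1 G2 s t ->
  abelian G1 -> G1 \isog G2.
Proof.
move=> Ds /abelian_structure[b defG _]; rewrite -(siso_full Ds).
elim: b {-2}G1 (subxx G1) defG => [|x b IHb] L sL.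
  rewrite big_nil => e; have -> : L = 1%G by apply/val_inj.
  by rewrite (siso1 Ds) trivial_isog.
rewrite big_cons => defL; have [[_ K _ eK] eL _ _] := dprodP defL.
rewrite eK in defL eL; have defL' : <[x]>%G \x K = L by [].
have [sxL sKL] : <[x]>%G \subset L /\ K \subset L.
  by rewrite -eL mulG_subl mulG_subr.
have sxG := subset_trans sxL sL.
apply: isog_dprod defL (div_dprod_imp Ds sL defL') _ _.
  rewrite isog_cyclic_card ?cycle_cyclic // (div_cyclicE Ds) // cycle_cyclic.
  by rewrite (siso_card Ds) // eqxx.
by apply: IHb eK; apply: subset_trans sL.
Qed.

(** * Normalizers, simplicity, semidirect products and generator rank *)

Section MoreConsequences.

Variables (gT1 gT2 : finGroupType) (G1 : {group gT1}) (G2 : {group gT2}).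
Variables (s : {group gT1} -> {group gT2}) (t : {group gT2} -> {group gT1}).
Hypothesis Ds : division_iso G1 G2 s t.
Let Hs : subgroup_iso G1 G2 s t := Ds.
Let Ds' := division_iso_sym Ds.
Implicit Types H K L C : {group gT1}.

Lemma div_abelian_full : abelian G1 = abelian G2.
Proof.
apply/idP/idP=> [cG | cG].
  by rewrite -(isog_abelian (div_abelian_isog Ds cG)).
by rewrite -(isog_abelian (div_abelian_isog Ds' cG)).
Qed.

Lemma div_dprod H K L : H \subset G1 -> K \subset G1 -> L \subset G1 ->
  H \x K = L <-> s H \x s K = s L.
Proof.
move=> sH sK sL; split; first exact: (div_dprod_imp Ds).
by move/(div_dprod_imp Ds' (siso_sub Hs sL)); rewrite !(sisoK Hs).
Qed.

Lemma div_norm_imp H : H \subset G1 -> s 'N_G1(H)%G \subset 'N_G2(s H).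
Proof.
move=> sH; have sN : 'N_G1(H)%G \subset G1 by apply: subsetIl.
have sHN : H \subset 'N_G1(H)%G by rewrite subsetI sH normG.
rewrite subsetI (siso_sub Hs) //= normal_norm // (div_normal Ds) //.
by rewrite normalSG.
Qed.

Lemma div_maxnormal_imp H K : H \subset G1 -> K \subset G1 ->
  maxnormal K H H -> maxnormal (s K) (s H) (s H).
Proof.
move=> sH sK /maxgroupP[/andP[pK nK] maxK]; apply/maxgroupP.
have normE L : L \subset H -> (s H \subset 'N(s L)) = (H \subset 'N(L)).
  move=> sL; have := div_normal Ds sL sH.
  by rewrite /normal sL (siso_mono Hs) ?sL ?(subset_trans sL).
split=> [|L /andP[pL nL] sL].
  by rewrite (siso_proper Hs) // pK (normE _ (proper_sub pK)).
have sL2 := subset_trans (proper_sub pL) (siso_sub Hs sH).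
have sT := siso_subV Hs sL2.
rewrite -(sisoKV Hs sL2) in pL sL nL *.
rewrite (siso_proper Hs) // in pL; rewrite (siso_mono Hs) // in sL.
rewrite (normE _ (proper_sub pL)) in nL.
by congr (gval (s _)); apply/val_inj/maxK; rewrite ?pL ?nL.
Qed.

Lemma div_simple_imp : simple G1 -> simple G2.
Proof.
case/simpleP=> nt simG; apply/simpleP; split=> [|N nsN].
  by rewrite -(siso_full Hs) (siso_trivg Hs).
have sN := normal_sub nsN; have sT := siso_subV Hs sN.
have [|e|e] := simG (t N); first by rewrite -(div_normal_full Ds) // (sisoKV Hs).
  by left; apply/eqP; rewrite -(sisoKV Hs sN) (siso_trivg Hs) // e.
right; rewrite -(sisoKV Hs sN) -(siso_full Hs); congr (gval (s _)).
exact/val_inj.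
Qed.

Lemma div_semidirect_imp : is_semidirect_product G1 -> is_semidirect_product G2.
Proof.
case=> H [K [ntH ntK defG]].
have [nsH _ _ nHK tiHK] := sdprod_context defG.
have sH := normal_sub nsH; have sK : K \subset G1 by case/sdprod_context: defG.
exists (s H), (s K); rewrite !(siso_trivg Hs) //; split=> //.
have nsH2 : s H <| G2 by rewrite (div_normal_full Ds).
rewrite sdprodEY.
- rewrite -[LHS]/(gval (s H <*> s K)%G) -(sisoY Hs) // -(siso_full Hs).
  by congr (gval (s _)); apply/val_inj; rewrite /= -(sdprodEY nHK tiHK).
- by rewrite (subset_trans (siso_sub Hs sK)) ?normal_norm.
rewrite -[LHS]/(gval (s H :&: s K)%G) -(sisoI Hs) //.
by rewrite (_ : H :&: K = 1)%G ?(siso1 Hs) //; apply/val_inj.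
Qed.

(** Each generator [x] is replaced by a generator of [s <[x]>]. The subgroup these generate contains
    every [s <[x]>], so its image under [t] contains every [x]. *)
Lemma div_grank_imp : 'm(G2) <= 'm(G1).
Proof.
have [B genB <-] := grank_witness G1.
have sB x : x \in B -> <[x]>%G \subset G1.
  by move=> Bx; rewrite cycle_subG -genB mem_gen.
have ex x : exists y, (x \in B) ==> (s <[x]>%G :==: <[y]>).
  case: (boolP (x \in B)) => [Bx|_]; last by exists 1.
  have /cyclicP[y e] := div_cyclic Ds (sB x Bx) (cycle_cyclic x).
  by exists y; rewrite e /=.
have [h hP] := fin_all_exists ex.
have hG x : x \in B -> h x \in G2.
  move=> Bx; have := hP x; rewrite Bx /= -cycle_subG => /eqP<-.
  by rewrite (siso_sub Hs) ?sB.
pose B2 := [set h x | x in B].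
have sG : <<B2>>%G \subset G2.
  by rewrite gen_subG; apply/subsetP=> _ /imsetP[x Bx ->]; apply: hG.
suff -> : G2 = <<B2>>%G :> {set _}.
  by apply: leq_trans (grank_min _) (leq_imset_card _ _).
have sT := siso_subV Hs sG.
rewrite -[RHS](congr1 (@gval _) (sisoKV Hs sG)) -(siso_full Hs).
congr (gval (s _)); apply/val_inj/eqP; rewrite eqEsubset sT andbT /=.
suff: <<B>> \subset t <<B2>>%G by rewrite genB.
rewrite gen_subG; apply/subsetP=> x Bx.
rewrite -cycle_subG -(siso_mono Hs (sB x Bx) sT) (sisoKV Hs sG).
by have := hP x; rewrite Bx => /eqP ->; rewrite cycle_subG mem_gen ?imset_f.
Qed.

End MoreConsequences.

(** * Centralizers, derived subgroup, solvability and nilpotency *)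

Lemma div_abelian (gT1 gT2 : finGroupType) (G1 : {group gT1}) (G2 : {group gT2})
    s t (H : {group gT1}) : division_iso G1 G2 s t ->
  H \subset G1 -> abelian (s H) = abelian H.
Proof. by move=> Ds sH; rewrite (div_abelian_full (div_restrict Ds sH)). Qed.

(** Two elements commute exactly when their cyclic groups have an abelian join, and cyclic
    subgroups, joins and abelian subgroups are all preserved. *)
Lemma div_cent_imp (gT1 gT2 : finGroupType) (G1 : {group gT1})
    (G2 : {group gT2}) s t (H K : {group gT1}) : division_iso G1 G2 s t ->
  H \subset G1 -> K \subset G1 -> K \subset 'C(H) -> s K \subset 'C(s H).
Proof.
move=> Ds sH sK cHK; have Hs : subgroup_iso G1 G2 s t := Ds.
apply/centsP=> y Ky z Hz.
have sy : <[y]>%G \subset G2 by rewrite cycle_subG (subsetP (siso_sub Hs sK)).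
have sz : <[z]>%G \subset G2 by rewrite cycle_subG (subsetP (siso_sub Hs sH)).
have [sty stz] := (siso_subV Hs sy, siso_subV Hs sz).
have tyK : t <[y]>%G \subset K.
  by rewrite -(siso_mono Hs) // (sisoKV Hs) // cycle_subG.
have tzH : t <[z]>%G \subset H.
  by rewrite -(siso_mono Hs) // (sisoKV Hs) // cycle_subG.
have cT (C : {group gT2}) : C \subset G2 -> cyclic C -> abelian (t C).
  by move=> sC cC; rewrite cyclic_abelian // (div_cyclicV Ds).
have abY : abelian (t <[y]> <*> t <[z]>)%G.
  rewrite /= abelianY !cT ?cycle_cyclic //=.
  by rewrite centsC (subset_trans tyK) // (subset_trans cHK) // centS.
have := abY; rewrite -(div_abelian Ds) ?join_subG ?sty //.
rewrite (sisoY Hs) // !(sisoKV Hs) // /= abelianY => /and3P[_ _].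
by rewrite cent_cycle cycle_subG => /cent1P.
Qed.

Lemma div_cent (gT1 gT2 : finGroupType) (G1 : {group gT1})
    (G2 : {group gT2}) s t (H : {group gT1}) : division_iso G1 G2 s t ->
  H \subset G1 -> s 'C_G1(H)%G = 'C_G2(s H)%G.
Proof.
move=> Ds sH; have Hs : subgroup_iso G1 G2 s t := Ds.
have sS := siso_sub Hs sH.
have sC1 : 'C_G1(H)%G \subset G1 := subsetIl _ _.
have sC2 : 'C_G2(s H)%G \subset G2 := subsetIl _ _.
apply: (siso_group_eq Hs) => //=; rewrite subsetI ?(siso_sub Hs) ?(siso_subV Hs) //=.
  by rewrite (div_cent_imp Ds) ?subsetIr.
rewrite -{2}(sisoK Hs sH).
by rewrite (div_cent_imp (division_iso_sym Ds)) ?subsetIr.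
Qed.

Lemma div_norm (gT1 gT2 : finGroupType) (G1 : {group gT1})
    (G2 : {group gT2}) s t (H : {group gT1}) : division_iso G1 G2 s t ->
  H \subset G1 -> s 'N_G1(H)%G = 'N_G2(s H)%G.
Proof.
move=> Ds sH; have Hs : subgroup_iso G1 G2 s t := Ds.
have sS := siso_sub Hs sH.
have sC1 : 'N_G1(H)%G \subset G1 := subsetIl _ _.
have sC2 : 'N_G2(s H)%G \subset G2 := subsetIl _ _.
apply: (siso_group_eq Hs) => //=; first exact: (div_norm_imp Ds sH).
by rewrite -{2}(sisoK Hs sH) (div_norm_imp (division_iso_sym Ds)).
Qed.

Lemma div_quotient_abelian (gT1 gT2 : finGroupType) (G1 : {group gT1})
    (G2 : {group gT2}) s t (N : {group gT1}) : division_iso G1 G2 s t ->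
  N <| G1 -> abelian (G2 / s N) = abelian (G1 / N).
Proof.
move=> Ds nsN; have nsM : s N <| G2 by rewrite (div_normal_full Ds) // normal_sub.
by rewrite (div_abelian_full (quo_div_iso Ds nsN nsM)).
Qed.

Lemma div_der1_imp (gT1 gT2 : finGroupType) (G1 : {group gT1})
    (G2 : {group gT2}) s t : division_iso G1 G2 s t ->
  [~: G2, G2] \subset s [~: G1, G1]%G.
Proof.
move=> Ds; have nsD : [~: G1, G1]%G <| G1 := der_normal 1 G1.
have nsM : s [~: G1, G1]%G <| G2 by rewrite (div_normal_full Ds) // normal_sub.
apply: der1_min; first exact: normal_norm.
by rewrite (div_quotient_abelian Ds) //; apply: (der_abelian 0 G1).
Qed.

Lemma div_der1 (gT1 gT2 : finGroupType) (G1 : {group gT1})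
    (G2 : {group gT2}) s t : division_iso G1 G2 s t ->
  s [~: G1, G1]%G = [~: G2, G2]%G.
Proof.
move=> Ds; have Hs : subgroup_iso G1 G2 s t := Ds.
have s1 : [~: G1, G1]%G \subset G1 := der_sub 1 G1.
have s2 : [~: G2, G2]%G \subset G2 := der_sub 1 G2.
have sT := siso_subV Hs s2.
apply/val_inj/eqP; rewrite eqEsubset (div_der1_imp Ds) andbT.
have := div_der1_imp (division_iso_sym Ds).
by rewrite -(siso_mono Hs s1 sT) (sisoKV Hs).
Qed.

(** Solvability means here that only the trivial subgroup lies in its own derived subgroup; derived
    subgroups of subgroups correspond by [div_der1] after restriction. *)
Lemma div_solvable_imp (gT1 gT2 : finGroupType) (G1 : {group gT1})
    (G2 : {group gT2}) s t : division_iso G1 G2 s t ->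
  solvable G1 -> solvable G2.
Proof.
move=> Ds /forall_inP solG; have Hs : subgroup_iso G1 G2 s t := Ds.
apply/forall_inP=> L; rewrite subsetI => /andP[sL perfL].
have sT := siso_subV Hs sL.
rewrite -(siso_trivg (subgroup_iso_sym Hs)) //; apply: solG.
have eD := congr1 (@gval _) (div_der1 (div_restrict (division_iso_sym Ds) sL)).
rewrite subsetI sT /= -eD.
by rewrite (siso_mono (subgroup_iso_sym Hs)) // (subset_trans (der_sub 1 L)).
Qed.

(** Induction on the order through the quotient by the center: centers correspond, and a nontrivial
    nilpotent group has a nontrivial center. *)
Lemma div_nilpotent_imp (gT1 gT2 : finGroupType) (G1 : {group gT1})
    (G2 : {group gT2}) s t : division_iso G1 G2 s t ->
  nilpotent G1 -> nilpotent G2.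
Proof.
have [n] := ubnP #|G1|.
elim: n => // n IHn in gT1 gT2 G1 G2 s t * => /ltnSE leGn Ds nilG.
have Hs : subgroup_iso G1 G2 s t := Ds.
have [G1_1|ntG] := eqVneq (G1 : {set gT1}) 1.
  suff -> : G2 :=: 1 by apply: nilpotent1.
  by apply/eqP; rewrite -(siso_full Hs) (siso_trivg Hs) // G1_1.
have eZ : s 'Z(G1)%G = 'Z(G2)%G.
  have := div_cent Ds (subxx G1); rewrite (siso_full Hs) => e.
  exact: e.
have nsZ := center_normal G1.
have nsM : s 'Z(G1)%G <| G2 by rewrite eZ center_normal.
have DQ := quo_div_iso Ds (nsZ : 'Z(G1)%G <| G1) nsM.
suff: nilpotent (G2 / s 'Z(G1)%G) by rewrite eZ quotient_center_nil.
apply: IHn DQ _; last exact: quotient_nil.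
apply: leq_trans leGn; apply: ltn_quotient; last exact: center_sub.
by rewrite center_nil_eq1.
Qed.

(** * Composition series and divisions *)

Lemma comps_consE (gT : finGroupType) (H K : {group gT}) r :
  comps H (K :: r) = maxnormal K H H && comps K r.
Proof. by rewrite /comps /= andbCA. Qed.

Lemma div_maxnormal (gT1 gT2 : finGroupType) (G1 : {group gT1})
    (G2 : {group gT2}) s t (H K : {group gT1}) : division_iso G1 G2 s t ->
  H \subset G1 -> K \subset G1 ->
  maxnormal (s K) (s H) (s H) = maxnormal K H H.
Proof.
move=> Ds sH sK; apply/idP/idP; last exact: (div_maxnormal_imp Ds).
move/(div_maxnormal_imp (division_iso_sym Ds) (siso_sub Ds sH) (siso_sub Ds sK)).
by rewrite !(sisoK Ds).
Qed.

Lemma div_comps (gT1 gT2 : finGroupType) (G1 : {group gT1})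
    (G2 : {group gT2}) s t (H : {group gT1}) (r : seq {group gT1}) :
    division_iso G1 G2 s t -> H \subset G1 ->
    {in r, forall K : {group gT1}, K \subset G1} ->
  comps (s H) (map s r) = comps H r.
Proof.
move=> Ds; elim: r H => [|K r IHr] H sH sr.
  by rewrite /comps /= !andbT -(siso1 Ds) (siso_eq Ds) ?sub1G.
have sK : K \subset G1 by rewrite sr ?mem_head.
rewrite /= !comps_consE (div_maxnormal Ds) // IHr // => L rL.
by rewrite sr // inE rL orbT.
Qed.

Lemma comps_sub (gT : finGroupType) (G : {group gT}) r :
  comps G r -> {in r, forall K : {group gT}, K \subset G}.
Proof.
elim: r G => // K r IHr G; rewrite comps_consE => /andP[/maxgroupp/andP[pK _]].
move=> /IHr sr L; rewrite inE => /predU1P[->|/sr sL]; first exact: proper_sub.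
exact: subset_trans sL (proper_sub pK).
Qed.

(** Jordan-Hoelder uniqueness permutes the isomorphism representatives [section_repr]; this lifts
    the permutation to the sections themselves. *)
Lemma perm_eq_map_lift (T1 T2 : eqType) (h : T1 -> T2) (r : seq T2) (l : seq T1) :
  perm_eq r (map h l) -> exists2 u, perm_eq u l & map h u = r.
Proof.
elim: r l => [|y r IHr] l p.
  by exists [::] => //; move: p; rewrite perm_sym => /perm_nilP; case: l.
have: y \in map h l by rewrite -(perm_mem p) mem_head.
case/mapP=> x lx ey; have pl := perm_to_rem lx.
have [u pu eu] : exists2 u, perm_eq u (rem x l) & map h u = r.
  by apply: IHr; rewrite -(perm_cons y) (perm_trans p) // {1}ey -map_cons perm_map.
exists (x :: u); rewrite /= ?eu ?ey //.
by rewrite perm_sym (perm_trans pl) // perm_cons perm_sym.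
Qed.

(** Group the elements by the cyclic subgroup they generate: each such subgroup is conjugate to
    [<[repr (val d)]>], and all its generators lie in the division. *)
Lemma card_division (gT : finGroupType) (G : {group gT})
    (d : {d | d \in divisions G}) :
  #|val d| = (#|[set <[x]>%G | x in val d]| * totient #[repr (val d)])%N.
Proof.
rewrite -sum1_card (partition_big_imset (fun x => <[x]>%G)) /= -sum_nat_const.
apply: eq_bigr => _ /imsetP[a da ->].
have [Ga [g Gg ea]] := division_mem d a da.
have -> : #[repr (val d)] = #[a] by rewrite /order ea cardJg.
rewrite totient_gen sum1_card; apply: eq_card => x; rewrite !inE.
apply/andP/eqP=> [[_ /eqP/(congr1 (@gval _))] //| ex].
split; last by apply/eqP/val_inj.
apply/division_mem; split; last by exists g; rewrite // -ex.
by apply: (subsetP (_ : <[a]> \subset G)); rewrite ?cycle_subG // ex cycle_id.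
Qed.

Lemma card_subgroups (gT : finGroupType) (G : {group gT}) :
  #|subgroups G| = #|{: subgroup_of G}|.
Proof. by rewrite card_sub; apply: eq_card => H; rewrite !inE. Qed.

Lemma cgraph_isomorphic_trans (C1 C2 C3 : finType) (g1 : cgraph C1)
    (g2 : cgraph C2) (g3 : cgraph C3) :
  cgraph_isomorphic g1 g2 -> cgraph_isomorphic g2 g3 -> cgraph_isomorphic g1 g3.
Proof.
move=> [s [f [bs bf cf af]]] [s' [f' [bs' bf' cf' af']]].
exists (s' \o s), (f' \o f); split=> [||v|u v] /=; try exact: bij_comp.
  by rewrite cf' cf.
by rewrite af' af.
Qed.

Lemma division_iso_isomorphic (gT1 gT2 : finGroupType) (G1 : {group gT1})
    (G2 : {group gT2}) s t : division_iso G1 G2 s t ->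
  cgraph_isomorphic (division_graph G1) (division_graph G2).
Proof.
by move=> Ds; have [f Hf] := division_iso_graph Ds; exists (subgroup_map Ds), f.
Qed.

Lemma isog_division_graph (gT1 gT2 : finGroupType) (G1 : {group gT1})
    (G2 : {group gT2}) : G1 \isog G2 ->
  cgraph_isomorphic (division_graph G1) (division_graph G2).
Proof.
case/isogP=> f injf fG; exact: (division_iso_isomorphic (isom_div_iso injf fG)).
Qed.

(** The factor [H / K] is compared with [s H / s K] by the quotient isomorphism, and the latter with
    a factor of [t2] by Jordan-Hoelder in [G2]; [u] is the resulting reordering of the factors of
    [t2]. *)
Lemma div_comps_factors (gT1 gT2 : finGroupType) (G1 : {group gT1})
    (G2 : {group gT2}) s t (t1 : seq {group gT1}) (t2 : seq {group gT2}) :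
    division_iso G1 G2 s t -> comps G1 t1 -> comps G2 t2 ->
  exists u : seq (section gT2),
    perm_eq u (composition_factors G2 t2) /\
    size u = size t1 /\
    forall i, i < size t1 ->
      cgraph_isomorphic
        (division_graph
           (section_group (nth (mkSec G1 G1) (composition_factors G1 t1) i)))
        (division_graph (section_group (nth (mkSec G2 G2) u i))).
Proof.
move=> Ds c1 c2; have st1 := comps_sub c1.
have c1' : comps G2 (map s t1).
  by rewrite -(siso_full Ds) (div_comps Ds).
have [u pu eu] := perm_eq_map_lift (JordanHolderUniqueness c1' c2).
have su : size u = size t1.
  by rewrite -(size_map (@section_repr _) u) eu size_map size_pairmap size_map.
exists u; split=> //; split=> // i lti.
pose H := nth G1 (G1 :: t1) i; pose K := nth G1 t1 i.
have e1 : nth (mkSec G1 G1) (composition_factors G1 t1) i = mkSec H K.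
  by rewrite (nth_pairmap G1).
have e2 : nth (mkSec G2 G2) (composition_factors G2 (map s t1)) i =
    mkSec (s H) (s K).
  rewrite (nth_pairmap G2) ?size_map // -(siso_full Ds) -map_cons.
  by rewrite !(nth_map G1) //= ltnW.
have iso2 : mkSec (s H) (s K) \isog nth (mkSec G2 G2) u i.
  have er : section_repr (nth (mkSec G2 G2) u i) = section_repr (mkSec (s H) (s K)).
    rewrite -e2 -!(nth_map _ (mkSec G2 G2)) ?size_pairmap ?size_map ?su //.
    by rewrite eu.
  rewrite isog_sym; apply: isog_trans (section_reprP (mkSec (s H) (s K))).
  by rewrite -er isog_sym section_reprP.
apply: cgraph_isomorphic_trans (isog_division_graph iso2); rewrite e1.
have sK : K \subset G1 by apply: st1; apply: mem_nth.
have sH : H \subset G1.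
  have: H \in G1 :: t1 by apply: mem_nth; rewrite /= ltnW.
  by rewrite inE => /predU1P[->|/st1].
have nsK : K <| H.
  have /pathP-/(_ G1 i lti) : path [rel x y : {group gT1} | maxnormal y x x] G1 t1.
    by case/compsP: c1.
  by move/maxnormal_normal.
have DH := div_restrict Ds sH.
have nsK2 : s K <| s H by rewrite (div_normal Ds) // normal_sub.
exact: (division_iso_isomorphic (quo_div_iso DH nsK nsK2)).
Qed.

(** * Generators and sizes of matched divisions *)

Lemma division_generators (gT : finGroupType) (G : {group gT})
    (d : {d | d \in divisions G}) (H : {group gT}) : H \subset G ->
  (exists2 x, x \in val d & H :=: <[x]>) <->
  (exists2 g, g \in G & H :=: <[repr (val d)]> :^ g).
Proof.
move=> sH; split=> [[x /division_mem[_ [g Gg e]] ->] | [g Gg eH]]; first by exists g.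
have /cyclicP[x ex] : cyclic H by rewrite eH cyclicJ cycle_cyclic.
exists x => //; apply/division_mem; split; last by exists g; rewrite -?ex.
by rewrite -cycle_subG -ex.
Qed.

Section DivisionMap.

Variables (gT1 gT2 : finGroupType) (G1 : {group gT1}) (G2 : {group gT2}).
Variables (s : {group gT1} -> {group gT2}) (t : {group gT2} -> {group gT1}).
Hypothesis Ds : division_iso G1 G2 s t.
Variables (d1 : {d | d \in divisions G1}) (d2 : {d | d \in divisions G2}).
Hypothesis d12 : exists2 y, y \in G2 &
  s <[repr (val d1)]>%G :=: <[repr (val d2)]> :^ y.

Lemma div_generators (H : {group gT1}) : H \subset G1 ->
  (exists2 x, x \in val d1 & H :=: <[x]>) <->
  (exists2 y, y \in val d2 & s H :=: <[y]>).
Proof.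
move=> sH; have sH2 := siso_sub Ds sH.
have sC : <[repr (val d1)]>%G \subset G1 by rewrite cycle_subG division_repr_in.
have [y Gy ey] := d12.
apply: (iff_trans (division_generators d1 sH)).
apply: (iff_trans (div_conj Ds sC sH (cycle_cyclic _))).
apply: iff_trans (iff_sym (division_generators d2 sH2)); rewrite ey.
split=> [[z Gz ->] | [z Gz ->]].
  by exists (y * z); rewrite ?groupM // conjsgM.
by exists (y^-1 * z); rewrite ?groupM ?groupV // conjsgM conjsgK.
Qed.

Lemma div_card_division : #|val d1| = #|val d2|.
Proof.
have sC : <[repr (val d1)]>%G \subset G1 by rewrite cycle_subG division_repr_in.
rewrite !card_division; congr (_ * totient _)%N; last first.
  by have [y _ ey] := d12; rewrite /order -(cardJg _ y) -ey (siso_card Ds).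
have sub1 x : x \in val d1 -> <[x]>%G \subset G1.
  by move=> dx; rewrite cycle_subG (subsetP (division_sub d1)).
have sub2 x : x \in val d2 -> <[x]>%G \subset G2.
  by move=> dx; rewrite cycle_subG (subsetP (division_sub d2)).
(* [s] matches the cyclic groups generated by elements of [d1] with those of [d2], so the two counts
   agree. *)
have -> : [set <[x]>%G | x in val d2] = [set s K | K in [set <[x]>%G | x in val d1]].
  apply/setP=> L; apply/imsetP/imsetP=> [[y dy ->] | [_ /imsetP[x dx ->] ->]].
    have sT := siso_subV Ds (sub2 y dy).
    exists (t <[y]>%G); last by rewrite (sisoKV Ds) ?sub2.
    have [|x dx ex] := (div_generators sT).2.
      by exists y; rewrite // (sisoKV Ds) ?sub2.
    by apply/imsetP; exists x => //; apply/val_inj.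
  have [|y dy ey] := (div_generators (sub1 x dx)).1; first by exists x.
  by exists y => //; apply/val_inj.
rewrite [RHS]card_in_imset // => _ _ /imsetP[x dx ->] /imsetP[y dy ->].
exact: (siso_inj Ds (sub1 x dx) (sub1 y dy)).
Qed.

End DivisionMap.

(** * Assembling the invariants *)

Lemma comps_zip_normal (gT : finGroupType) (G : {group gT})
    (r : seq (subgroup_of G)) (H0 H K : subgroup_of G) :
    comps H0 [seq sgval L | L <- r] -> (H, K) \in zip (H0 :: r) r ->
  K <| H.
Proof.
elim: r H0 => //= L r IHr H0; rewrite comps_consE => /andP[maxL cr].
by rewrite inE => /predU1P[[-> ->]|/(IHr L cr) //]; apply: maxnormal_normal maxL.
Qed.

Theorem theorem4p1 (gT1 gT2 : finGroupType)
    (G1 : {group gT1}) (G2 : {group gT2})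
    (s : subgroup_of G1 -> subgroup_of G2)
    (f : division_graph G1 -> division_graph G2)
    (iso_sf : cgraph_iso s f) :
  (* (1) *)
  #|G1| = #|G2| /\
  (* (2) *)
  (#|subgroups G1| = #|subgroups G2| /\
   (forall H : subgroup_of G1, #|s H| = #|H|) /\
   @cgraph_iso _ _ (subgroup_graph G1) (subgroup_graph G2) s s /\
   (forall H K : subgroup_of G1, (s H \subset s K) = (H \subset K)) /\
   (forall H K L : subgroup_of G1, L :=: H :&: K <-> s L :=: s H :&: s K) /\
   (forall H K L : subgroup_of G1, L :=: H <*> K <-> s L :=: s H <*> s K)) /\
  (* (3) *)
  ((forall H : subgroup_of G1, (s H <| G2) = (H <| G1)) /\
   simple G1 = simple G2) /\
  (* (4) *)
  (forall H : subgroup_of G1, same_division_graph s H) /\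
  (* (5) *)
  (forall H : subgroup_of G1, H <| G1 ->
     same_quotient_division_graph s G1 G2 H) /\
  (* (6) *)
  #|divisions G1| = #|divisions G2| /\
  (* (7) *)
  ((forall H : subgroup_of G1, cyclic (s H) = cyclic H) /\
   cyclic G1 = cyclic G2) /\
  (* (8) *)
  (forall d1 : {set gT1}, d1 \in divisions G1 ->
     exists d2 : {set gT2},
       d2 \in divisions G2 /\
       (forall v : division_graph G1,
          division_of v = d1 <-> division_of (f v) = d2) /\
       #|d1| = #|d2| /\
       (forall H : subgroup_of G1,
          (exists2 x, x \in d1 & H :=: <[x]>) <->
          (exists2 y, y \in d2 & s H :=: <[y]>))) /\
  (* (9) *)
  (forall H K : subgroup_of G1, cyclic H -> cyclic K ->
     (exists2 x, x \in G1 & K :=: H :^ x) <->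
     (exists2 y, y \in G2 & s K :=: s H :^ y)) /\
  (* (10) *)
  'm(G1) = 'm(G2) /\
  (* (11) *)
  (forall H K : subgroup_of G1, K :=: 'N_G1(H) <-> s K :=: 'N_G2(s H)) /\
  (* (12) *)
  (abelian G1 = abelian G2 /\
   (abelian G1 -> abelian_type G1 = abelian_type G2 /\ G1 \isog G2)) /\
  (* (13) *)
  (forall H : subgroup_of G1, abelian (s H) = abelian H) /\
  (* (14) *)
  ((forall H : subgroup_of G1, H :=: 'Z(G1) <-> s H :=: 'Z(G2)) /\
   (forall H K : subgroup_of G1, K :=: 'C_G1(H) <-> s K :=: 'C_G2(s H))) /\
  (* (15) *)
  ((forall H K : subgroup_of G1, H \x K = G1 <-> s H \x s K = G2) /\
   (forall t : seq (subgroup_of G1),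
      \big[dprod/1]_(H <- t) (H : {set gT1}) = G1 <->
      \big[dprod/1]_(H <- t) (s H : {set gT2}) = G2)) /\
  (* (16) *)
  (is_semidirect_product G1 <-> is_semidirect_product G2) /\
  (* (17) *)
  ((forall t : seq (subgroup_of G1),
      comps G2 [seq sgval (s H) | H <- t]
        = comps G1 [seq sgval H | H <- t]) /\
   (forall t : seq (subgroup_of G1),
      comps G1 [seq sgval H | H <- t] ->
      forall H K : subgroup_of G1, (H, K) \in zip (subgroupT G1 :: t) t ->
        same_division_graph s H /\ same_division_graph s K /\
        same_quotient_division_graph s H (s H) K) /\
   (forall (t1 : seq {group gT1}) (t2 : seq {group gT2}),
      comps G1 t1 -> comps G2 t2 ->
      exists u : seq (section gT2),
        perm_eq u (composition_factors G2 t2) /\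
        size u = size t1 /\
        forall i, i < size t1 ->
          cgraph_isomorphic
            (division_graph
               (section_group (nth (mkSec G1 G1) (composition_factors G1 t1) i)))
            (division_graph (section_group (nth (mkSec G2 G2) u i))))) /\
  (* (18) *)
  (forall H : subgroup_of G1, H :=: [~: G1, G1] <-> s H :=: [~: G2, G2]) /\
  (* (19) *)
  (nilpotent G1 = nilpotent G2 /\ solvable G1 = solvable G2).

Proof.
have [S [T [Ds SE [delta [dbij dE dconj]]]]] := cgraph_iso_division_iso iso_sf.
have [bij_s bij_f _ _] := iso_sf.
have Hs : subgroup_iso G1 G2 S T := Ds.
have Ds' := division_iso_sym Ds.
have sub (H : subgroup_of G1) : H \subset G1 := valP H.
(* Each claim on a position reduces, by injectivity of [S], to an equation [S X1 = X2]. *)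
have pos (H : subgroup_of G1) (X1 : {group gT1}) (X2 : {group gT2}) :
    X1 \subset G1 -> S X1 = X2 -> H :=: X1 <-> s H :=: X2.
  move=> sX1 eX; rewrite -SE -eX; split=> [e | /val_inj e].
    by congr (gval (S _)); apply/val_inj.
  by rewrite (siso_inj Hs (sub H) sX1 e).
have sdg (H : subgroup_of G1) : same_division_graph s H.
  have DH := div_restrict Ds (sub H); rewrite SE in DH.
  have [g Hg] := division_iso_graph DH.
  exists (subgroup_map DH), g; split=> // K L e.
  by rewrite /= -SE; congr (gval (S _)); apply/val_inj.
have sqdg (A1 : {group gT1}) (A2 : {group gT2}) (N : subgroup_of G1) :
    A1 \subset G1 -> S A1 = A2 -> N <| A1 -> same_quotient_division_graph s A1 A2 N.
  move=> sA <- nsN; have DA := div_restrict Ds sA.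
  have nsM : S N <| S A1 by rewrite (div_normal Ds) // normal_sub.
  have DQ := quo_div_iso DA nsN nsM; rewrite SE in DQ.
  have [g Hg] := division_iso_graph DQ; exists (subgroup_map DQ), g.
  split=> // K L sNL sL eK; have eK' : sgval K = (L / N)%G by apply/val_inj.
  rewrite -[LHS]/(gval (quotient_map S (s N) K)) eK'.
  by rewrite (quotient_mapE _ _ (normalS sNL sL nsN)) SE.
split; first by rewrite -(siso_full Hs) (siso_card Hs).
split.
  split; first by rewrite !card_subgroups (bij_eq_card bij_s).
  split; first by move=> H; rewrite -SE (siso_card Hs).
  split.
    split=> // H K /=; rewrite -!SE (siso_maximal Hs) //.
    case: ifP => // /maxgroupp/proper_sub sK.
    by rewrite -!divgS ?(siso_mono Hs) // !(siso_card Hs).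
  split; first by move=> H K; rewrite -!SE (siso_mono Hs).
  split=> H K L.
    have sI : (H :&: K)%G \subset G1 by rewrite subIset ?sub.
    by apply: (pos L _ (s H :&: s K)%G sI); rewrite (sisoI Hs) // !SE.
  have sY : (H <*> K)%G \subset G1 by rewrite join_subG !sub.
  by apply: (pos L _ (s H <*> s K)%G sY); rewrite (sisoY Hs) // !SE.
split.
  split; first by move=> H; rewrite -SE (div_normal_full Ds).
  by apply/idP/idP; [apply: (div_simple_imp Ds) | apply: (div_simple_imp Ds')].
split=> //.
split; first by move=> H; apply: sqdg => //; apply: (siso_full Hs).
split; first by have := bij_eq_card dbij; rewrite !card_sig.
split.
  split; first by move=> H; rewrite -SE (div_cyclicE Ds).
  by rewrite -(div_cyclicE Ds (subxx G1)) (siso_full Hs).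
split.
  move=> d1 dd1; pose d : {d | d \in divisions G1} := exist _ d1 dd1.
  exists (val (delta d)); split; first exact: valP.
  split.
    move=> v; rewrite /division_of -[tag v]/(vdiv v) -[tag (f v)]/(vdiv (f v)) dE.
    split=> [e | /val_inj/(bij_inj dbij)-> //].
    by congr (val (delta _)); apply/val_inj.
  split; first exact: (div_card_division Ds (dconj d)).
  by move=> H; rewrite -SE; apply: (div_generators Ds (dconj d)).
split; first by move=> H K cH _; rewrite -!SE; apply: (div_conj Ds).
split.
  by apply/eqP; rewrite eqn_leq (div_grank_imp Ds) (div_grank_imp Ds').
split.
  move=> H K; apply: (pos K _ 'N_G2(s H)%G (subsetIl _ _)).
  by rewrite (div_norm Ds) // SE.
split.
  split; first exact: (div_abelian_full Ds).
  move=> cG; have iso := div_abelian_isog Ds cG.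
  by split=> //; apply: isog_abelian_type.
split; first by move=> H; rewrite -SE (div_abelian Ds).
split.
  split=> [H | H K].
    apply: (pos H _ 'Z(G2)%G (subsetIl _ _)).
    by have := div_cent Ds (subxx G1); rewrite (siso_full Hs).
  apply: (pos K _ 'C_G2(s H)%G (subsetIl _ _)).
  by rewrite (div_cent Ds) // SE.
split.
  split=> [H K | r].
    by rewrite -!SE -(siso_full Hs); apply: (div_dprod Ds).
  (* For the converse, the inverse isomorphism is applied to the list [r2] of images. *)
  pose r1 := [seq sgval H | H <- r]; pose r2 := [seq S H | H <- r1].
  split=> defG.
    have := @div_bigdprod_imp _ _ _ _ _ _ r1 _ Ds (subxx G1).
    rewrite !big_map (siso_full Hs) => /(_ defG) <-.
    by apply: eq_bigr => H _; rewrite SE.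
  have := @div_bigdprod_imp _ _ _ _ _ _ r2 _ Ds' (subxx G2).
  rewrite !big_map (siso_full (subgroup_iso_sym Hs)) => <-.
    by apply: eq_bigr => H _; rewrite (sisoK Hs).
  by rewrite -defG; apply: eq_bigr => H _; rewrite SE.
split.
  by split; [apply: (div_semidirect_imp Ds) | apply: (div_semidirect_imp Ds')].
have compsE (r : seq (subgroup_of G1)) :
    comps G2 [seq sgval (s H) | H <- r] = comps G1 [seq sgval H | H <- r].
  have -> : [seq sgval (s H) | H <- r] = map S [seq sgval H | H <- r].
    by rewrite -map_comp; apply: eq_map => H /=; rewrite SE.
  rewrite -(siso_full Hs); apply: (div_comps Ds) => // _ /mapP[H _ ->].
  exact: sub.
split.
  split=> //; split; last by move=> t1 t2; apply: (div_comps_factors Ds).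
  move=> r cr H K HK; split=> //; split=> //.
  by apply: sqdg; [apply: sub | apply: SE | apply: (comps_zip_normal _ HK)].
split.
  move=> H; apply: (pos H [~: G1, G1]%G [~: G2, G2]%G (der_sub 1 G1)).
  exact: (div_der1 Ds).
split; apply/idP/idP.
- exact: (div_nilpotent_imp Ds).
- exact: (div_nilpotent_imp Ds').
- exact: (div_solvable_imp Ds).
- exact: (div_solvable_imp Ds').
Qed.
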